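(* For two alphabets $X$ and $Y$, $$\sum_{\lambda\in\mathrm{SP}}\ \sum_{\mu\in\mathrm{SP}(|\lambda|)}C_{\lambda\mu}(t,s)\,Q_\mu(X)\,P_\lambda(Y)=\exp\!\left(2\sum_{\substack{n\ge1\\ n\text{ odd}}}\frac{1-t^n}{1-s^n}\,\frac{p_n(X)p_n(Y)}{n}\right),$$ as an identity in the completion (with respect to degree) of $\Gamma(X)\otimes\Gamma(Y)$ over $\mathbb{Q}(t,s)$, where $\mathrm{SP}=\bigcup_{N\ge0}\mathrm{SP}(N)$.
   Context: A strict partition is a finite sequence $\lambda=(\lambda_1>\cdots>\lambda_\ell>0)$ of integers, with $|\lambda|=\sum\lambda_i$, $\ell(\lambda)=\ell$; $\mathrm{SP}(N)$ is the set of strict partitions of $N$. Let $\Gamma=\mathbb{Q}[p_1,p_3,p_5,\ldots]$ be the ring of odd power sums, graded by $\deg p_n=n$, with degree-$N$ component $\Gamma_N$; $f(X)$, $f(Y)$ denote $f\in\Gamma$ evaluated in two independent copies of $\Gamma$ (two alphabets). The Schur $Q$-functions $Q_\lambda\in\Gamma$ are defined as follows: $q_r$ is given by $\sum_{r\ge0}q_rz^r=\exp\bigl(2\sum_{n\ge1,\ n\text{ odd}}\frac{p_n}{n}z^n\bigr)$; for $r\ge s\ge0$ let $Q_{(r,s)}=q_rq_s+2\sum_{k=1}^{s}(-1)^kq_{r+k}q_{s-k}$; in general $Q_\lambda$ is the Pfaffian of the antisymmetric matrix with entries $Q_{(\lambda_i,\lambda_j)}$ for $i<j$, where a zero part is appended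 to $\lambda$ if $\ell(\lambda)$ is odd (so $Q_{(r)}=q_r$, $Q_\varnothing=1$). $\{Q_\lambda:\lambda\in\mathrm{SP}(N)\}$ is a basis of $\Gamma_N$. Set $P_\lambda=2^{-\ell(\lambda)}Q_\lambda$. Standard fact from the classical theory of Schur $Q$-functions (Macdonald's book on symmetric functions; the classical Cauchy identity): $\sum_{\lambda\in\mathrm{SP}}Q_\lambda(X)P_\lambda(Y)=\exp\bigl(2\sum_{n\text{ odd}}p_n(X)p_n(Y)/n\bigr)$. Let $t,s$ be independent indeterminates, with scalars extended to $\mathbb{Q}(t,s)$. Let $T_{t,s}$ be the algebra automorphism of $\Gamma$ (after extension of scalars) with $T_{t,s}(p_n)=\frac{1-t^n}{1-s^n}p_n$ for $n$ odd. Define $C_{\lambda\mu}(t,s)$, for $\lambda,\mu\in\mathrm{SP}(N)$, by $T_{t,s}Q_\lambda=\sum_{\mu\in\mathrm{SP}(N)}C_{\lambda\mu}(t,s)Q_\mu$. *)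

(* Defs.v *)
From HB Require Import structures.
From mathcomp Require Import all_boot all_order all_algebra all_fingroup.
From mathcomp Require Import finmap monalg.
Set Implicit Arguments.
Unset Strict Implicit.
Unset Printing Implicit Defensive.
Import GRing.Theory.
Local Open Scope ring_scope.

(* The polynomial ring over K in the possibly infinitely many variables
   indexed by I. *)
Notation "{ 'pring' K [ I ] }" := {malg K[{cmonom I}]}
  (at level 0, K, I at level 2, format "{ 'pring'  K [ I ] }") : type_scope.

(* pvar and psubst are locked because failed conversions between distinct
   variables or substitutions would otherwise unfold finite maps. *)
HB.lock Definition pvar (K : comNzRingType) (I : choiceType) (i : I) :
    {pring K[I]} := << ucm i >>.
Arguments pvar K {I} i.

Section PolynomialRing.
Variables (K : comNzRingType) (I : choiceType).

(* Degree of a monomial, and homogeneous component of degree d of a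
   polynomial, when the variable i has degree w i. *)
Definition wdeg (w : I -> nat) (m : {cmonom I}) : nat :=
  (\sum_(i <- finsupp m) m i * w i)%N.

Definition hcomp (w : I -> nat) (d : nat) (f : {pring K[I]}) : {pring K[I]} :=
  \sum_(m <- msupp f | wdeg w m == d) << f@_m *g m >>.

Lemma hcomp0 w d : hcomp w d 0 = 0.
Proof. by rewrite /hcomp msupp0 big_mkcond big_seq_fset0. Qed.

Lemma hcompU w d c (m : {cmonom I}) :
  hcomp w d << c *g m >> = if wdeg w m == d then << c *g m >> else 0.
Proof.
rewrite /hcomp big_mkcond msuppU; case: (eqVneq c 0) => [->|_].
  by rewrite big_seq_fset0 monalgU0 if_same.
by rewrite big_seq_fset1 mcoeffUU.
Qed.

Lemma scale_mono (c : K) (m : {cmonom I}) :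
  c *: << m >> = << c *g m >> :> {pring K[I]}.
Proof. by rewrite malgZ_def /fgscale msuppU1 big_seq_fset1 mcoeffUU mulr1. Qed.

End PolynomialRing.

Definition mmon (K : comNzRingType) (I J : choiceType)
    (v : I -> {pring K[J]}) (m : {cmonom I}) : {pring K[J]} :=
  \prod_(i <- finsupp m) v i ^+ (m i).

(* The K-algebra morphism sending each variable i to v i. *)
HB.lock Definition psubst (K : comNzRingType) (I J : choiceType)
    (v : I -> {pring K[J]}) (f : {pring K[I]}) : {pring K[J]} :=
  mmap (@malgC {cmonom J} K) (mmon v) f.

Section Substitution.
Variables (K : comNzRingType) (I J : choiceType).
Implicit Type v : I -> {pring K[J]}.

Lemma mmon_morph v : mmorphism (mmon v).
Proof.
have mmonEw (m : {cmonom I}) (d : {fset I}) : (finsupp m `<=` d)%fset ->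
    mmon v m = \prod_(i <- d) v i ^+ (m i).
  move=> le; rewrite /mmon (big_fset_incl _ le) // => i _.
  by move/fsfun_dflt ->.
split=> [m1 m2|]; last by rewrite /mmon mdom1 big_seq_fset0.
rewrite (mmonEw _ _ (fsubset_refl _)).
rewrite (mmonEw m1 (finsupp m1 `|` finsupp m2)%fset) ?fsubsetUl //.
rewrite (mmonEw m2 (finsupp m1 `|` finsupp m2)%fset) ?fsubsetUr //.
by rewrite mdomD -big_split /=; apply: eq_bigr => i _; rewrite cmM exprD.
Qed.

HB.instance Definition _ v := isMultiplicative.Build _ _ (mmon v) (mmon_morph v).
Lemma psubstE v f : psubst v f = mmap (@malgC {cmonom J} K) (mmon v) f.
Proof. by rewrite psubst.unlock. Qed.

Lemma psubst_additive v : additive (psubst v).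
Proof. by move=> f g; rewrite !psubstE raddfB. Qed.

HB.instance Definition _ v := GRing.isAdditive.Build _ _ (psubst v)
  (psubst_additive v).

Lemma psubst_multiplicative v : multiplicative (psubst v).
Proof. by split=> [f g|]; rewrite !psubstE ?rmorphM ?rmorph1. Qed.

HB.instance Definition _ v := GRing.isMultiplicative.Build _ _ (psubst v)
  (psubst_multiplicative v).

Lemma psubst_scalable v : scalable (psubst v).
Proof. by move=> c f; rewrite !psubstE mmapZ mul_malgC. Qed.

HB.instance Definition _ v :=
  GRing.isScalable.Build K {pring K[I]} {pring K[J]} *:%R (psubst v)
    (psubst_scalable v).

Lemma psubst_var v i : psubst v (pvar K i) = v i.
Proof.
by rewrite psubstE pvar.unlock mmapU /= mul1r /mmon mdomU big_seq_fset1 cmUU expr1.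
Qed.

End Substitution.

(* A sequence of ring elements is either the coefficients of a formal power
   series in z, or the homogeneous components of an element of the completion
   of a graded ring (which is the product of the graded pieces). Both have the
   same product, and both carry the product of discrete topologies. *)
Definition series (R : Type) := nat -> R.

Section Series.
Variable R : comNzRingType.

Definition series1 : series R := fun d => (d == 0%N)%:R.

Definition mul_series (f g : series R) : series R :=
  fun d => \sum_(i < d.+1) f i * g (d - i)%N.

Definition pow_series (f : series R) (k : nat) : series R :=
  iter k (mul_series f) series1.

(* Unconditional convergence of a family of series to g. *)
Definition has_sum (I : eqType) (F : I -> series R) (g : series R) : Prop :=
  forall d : nat, exists s0 : seq I,
    forall s : seq I, uniq s -> {subset s0 <= s} ->
      \sum_(i <- s) F i d = g d.

End Series.

Section SeriesExp.
Variables (K : fieldType) (R : comAlgType K).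

(* Exponential of a series f with f 0 = 0: then f ^ k starts in degree k, so
   that truncating the exponential sum at k = d does not change component d. *)
Definition exp_series (f : series R) : series R :=
  fun d => \sum_(k < d.+1) (k`!%:R^-1 : K) *: pow_series f k d.

Lemma pow_series_lt (f : series R) k d :
  f 0%N = 0 -> (d < k)%N -> pow_series f k d = 0.
Proof.
move=> f0; elim: k d => // k IHk d ltdk.
rewrite [LHS]big1 // => -[[|i] /= lti] _; first by rewrite f0 mul0r.
rewrite -[RHS](mulr0 (f i.+1)); congr (_ * _); apply: IHk.
by rewrite ltn_subLR // addSn (leq_trans ltdk) // ltnS leq_addl.
Qed.

Lemma has_sum_nat (F : nat -> series R) (g : series R) :
  (forall d n, (d < n)%N -> F n d = 0) ->
  (forall d, g d = \sum_(n < d.+1) F n d) -> has_sum F g.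
Proof.
move=> F0 gE d; exists (iota 0 d.+1) => s Us sub.
rewrite gE -(big_mkord xpredT (F^~ d)) /index_iota subn0.
rewrite (bigID [pred n | n < d.+1]%N) /= [X in _ + X]big1 ?addr0; last first.
  by move=> n; rewrite -leqNgt; apply: F0.
rewrite -big_filter; apply: perm_big; rewrite -/(iota 0 d.+1).
apply: uniq_perm; [exact: filter_uniq | exact: (iota_uniq 0 d.+1) | move=> n].
rewrite mem_filter -/(iota 0 d.+1) mem_iota add0n /=.
by case: ltnP => //= ltnd; apply: sub; rewrite mem_iota.
Qed.

Lemma exp_seriesP (f : series R) : f 0%N = 0 ->
  has_sum (fun k d => (k`!%:R^-1 : K) *: pow_series f k d) (exp_series f).
Proof.
by move=> f0; apply: has_sum_nat => // d n ltdn; rewrite pow_series_lt ?scaler0.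
Qed.

End SeriesExp.

Section Pfaffian.
Variables (K : fieldType) (R : comAlgType K).

Lemma pf_fst_subproof m (i : 'I_m) : (i.*2 < m.*2)%N.
Proof. by rewrite ltn_double. Qed.

Definition pf_fst m (i : 'I_m) : 'I_(m.*2) := Ordinal (pf_fst_subproof i).

Lemma pf_snd_subproof m (i : 'I_m) : (i.*2.+1 < m.*2)%N.
Proof. by rewrite -doubleS leq_double. Qed.

Definition pf_snd m (i : 'I_m) : 'I_(m.*2) := Ordinal (pf_snd_subproof i).

(* The sum over all permutations counts each perfect matching 2 ^ m * m! times,
   always with the same sign when A is antisymmetric. *)
Definition pfaffian m (A : 'M[R]_(m.*2)) : R :=
  ((2 ^ m * m`!)%:R^-1 : K) *:
    \sum_(s : 'S_(m.*2))
      (-1) ^+ odd_perm s * \prod_(i < m) A (s (pf_fst i)) (s (pf_snd i)).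

End Pfaffian.

Definition is_spart (l : seq nat) : bool := sorted gtn l && (0%N \notin l).

Record spart := SPart { parts :> seq nat; _ : is_spart parts }.
HB.instance Definition _ := [isSub for parts].
HB.instance Definition _ := [Countable of spart by <:].

(* The strict partitions of N are the subsequences of N, N - 1, ..., 1 of
   sum N. *)
Definition SP (N : nat) : seq spart :=
  pmap insub
    [seq l <- [seq mask b (rev (iota 1 N)) | b : N.-tuple bool] | sumn l == N].

Lemma subseq_SP (l : seq nat) (n : nat) :
  is_spart l -> all (leq^~ n) l -> subseq l (rev (iota 1 n)).
Proof.
elim: n l => [|n IHn] [|x l]; rewrite ?sub0seq //.
  by case: x => // /andP[_]; rewrite inE.
have -> : rev (iota 1 n.+1) = n.+1 :: rev (iota 1 n).
  by rewrite -[n.+1 in LHS]addn1 iotaD rev_cat add1n.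
move=> /= /andP[/=].
rewrite (path_sortedE (rev_trans ltn_trans)) inE => /andP[gtx sl].
rewrite negb_or => /andP[x0 l0] /andP[lex lel].
case: (eqVneq x n.+1) => [xE|neq]; last first.
  have lex' : (x <= n)%N by rewrite -ltnS ltn_neqAle neq.
  apply: (IHn (x :: l)).
    rewrite /is_spart inE negb_or x0 l0 andbT /=.
    by rewrite (path_sortedE (rev_trans ltn_trans)) gtx sl.
  rewrite /= lex'; apply/allP => y /(allP gtx) /= ltyx.
  exact: leq_trans (ltnW ltyx) lex'.
apply: IHn; first by rewrite /is_spart sl.
by apply/allP => y /(allP gtx) /=; rewrite xE ltnS.
Qed.

Lemma mem_SP N (l : spart) : (l \in SP N) = (sumn l == N).
Proof.
rewrite mem_pmap_sub mem_filter /=; case: eqP => //= sumE.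
apply/mapP.
have /subseqP[b sb lE] : subseq l (rev (iota 1 N)).
  apply: subseq_SP; first by case: l sumE.
  apply/allP => x xl; rewrite -sumE; move: xl; elim: (val l) => //= y s IHs.
  rewrite inE => /predU1P[->|/IHs]; first exact: leq_addr.
  by move=> h; apply: leq_trans h (leq_addl _ _).
rewrite size_rev size_iota in sb.
by exists (Tuple (introT eqP sb)); rewrite ?mem_enum.
Qed.

Lemma mask_inj_uniq (r : seq nat) b1 b2 : uniq r ->
  size b1 = size r -> size b2 = size r -> mask b1 r = mask b2 r -> b1 = b2.
Proof.
elim: r b1 b2 => [|x r IHr] [|x1 b1] [|x2 b2] //= /andP[xr ur] [sz1] [sz2].
case: x1 x2 => [] [] eqm; first by case: eqm => /IHr->.
- by case/negP: xr; apply: (@mem_mask _ _ b2); rewrite -eqm mem_head.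
- by case/negP: xr; apply: (@mem_mask _ _ b1); rewrite eqm mem_head.
by rewrite (IHr b1 b2).
Qed.

Lemma SP_uniq N : uniq (SP N).
Proof.
apply: pmap_sub_uniq; apply: filter_uniq; rewrite map_inj_uniq ?enum_uniq //.
move=> b1 b2 eqm; apply/val_inj; apply: mask_inj_uniq eqm.
- by rewrite rev_uniq iota_uniq.
- by rewrite size_rev size_iota size_tuple.
by rewrite size_rev size_iota size_tuple.
Qed.

Definition idx : choiceType := nat.
Definition idx2 : choiceType := (idx + idx)%type.

Section SchurQ.
Variable K : fieldType.

(* K[p_1, p_3, p_5, ...], i.e. Gamma with scalars extended from Q to K: the
   variable of index i is p_(2i+1). *)
Definition Gamma := {pring K[idx]}.

(* Meant for odd n only. *)
Definition psum (n : nat) : Gamma := if odd n then pvar K (n./2 : idx) else 0.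

Definition qfun (r : nat) : Gamma :=
  exp_series (fun n => if odd n then (2%:R / n%:R : K) *: psum n else 0) r.

Definition Q2 (r s : nat) : Gamma :=
  qfun r * qfun s
  + 2%:R * \sum_(1 <= k < s.+1) (-1) ^+ k * (qfun (r + k) * qfun (s - k)).

(* The size of the matrix is size l rounded up to an even number, and
   nth 0 l supplies the zero part when size l is odd. *)
Definition Qmx (l : seq nat) : 'M[Gamma]_((uphalf (size l)).*2) :=
  \matrix_(i, j)
    if (i < j)%N then Q2 (nth 0%N l i) (nth 0%N l j)
    else if (j < i)%N then - Q2 (nth 0%N l j) (nth 0%N l i)
    else 0.

Definition schurQ (l : spart) : Gamma := pfaffian (Qmx l).

Definition schurP (l : spart) : Gamma :=
  ((2%:R ^+ size l)^-1 : K) *: schurQ l.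

(* Gamma(X) (x) Gamma(Y), as the polynomial ring in the variables
   p_(2i+1)(X), indexed by inl i, and p_(2i+1)(Y), indexed by inr i. *)
Definition Gamma2 := {pring K[idx2]}.

Definition inX : Gamma -> Gamma2 := psubst (fun i => pvar K (inl i : idx2)).
Definition inY : Gamma -> Gamma2 := psubst (fun i => pvar K (inr i : idx2)).

Definition deg2 (x : idx2) : nat :=
  match x with inl i | inr i => i.*2.+1 end.

(* The embedding of Gamma(X) (x) Gamma(Y) into its completion. *)
Definition compl (f : Gamma2) : series Gamma2 := fun d => hcomp deg2 d f.

Lemma compl_ppXY (c : K) n d : odd n -> (d < n)%N ->
  compl (c *: (inX (psum n) * inY (psum n))) d = 0.
Proof.
move=> on ltdn; rewrite /psum on /inX /inY !psubst_var pvar.unlock.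
have -> : c *: (<< ucm (inl n./2 : idx2) >> * << ucm (inr n./2 : idx2) >>) =
    << c *g mmul (ucm (inl n./2 : idx2)) (ucm (inr n./2 : idx2)) >> :> Gamma2.
  by rewrite malgM_def fgmulUU mulr1 scale_mono.
rewrite /compl hcompU ifN // /wdeg mdomD !mdomU.
rewrite big_fsetU1 ?inE //= big_seq_fset1 !cmM !cmU /=.
have -> : n./2.*2.+1 = n by rewrite -[RHS]odd_double_half on.
by rewrite !eqxx /= gtn_eqF // addn0 add0n !mul1n ltn_addl.
Qed.

Variables t s : K.

Definition ratio (n : nat) : K := (1 - t ^+ n) / (1 - s ^+ n).

Definition Tts : Gamma -> Gamma :=
  psubst (fun i : idx => ratio i.*2.+1 *: psum i.*2.+1).

Lemma Tts_psum n : odd n -> Tts (psum n) = ratio n *: psum n.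
Proof.
move=> on; rewrite {1}/psum on /Tts psubst_var.
by have -> : n./2.*2.+1 = n by rewrite -[RHS]odd_double_half on.
Qed.

Definition kernel_term (n : nat) : Gamma2 :=
  if odd n then (2%:R * ratio n / n%:R) *: (inX (psum n) * inY (psum n))
  else 0.

Definition kernel_exponent : series Gamma2 :=
  fun d => \sum_(n < d.+1) compl (kernel_term n) d.

Lemma kernel_exponentP :
  has_sum (fun n => compl (kernel_term n)) kernel_exponent.
Proof.
apply: (@has_sum_nat K) => // d n ltdn; rewrite /kernel_term.
by case: ifP => on; [apply: compl_ppXY | apply: hcomp0].
Qed.

End SchurQ.

(* Q(t, s), as the field of fractions of Q[t][s]. *)
Definition Qts : fieldType := {fraction {poly {poly rat}}}.
Definition vt : Qts := tofrac ('X%:P).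
Definition vs : Qts := tofrac 'X.

(* Main.v *)
Require Import Defs.
From HB Require Import structures.
From mathcomp Require Import all_boot all_order all_algebra all_fingroup.
From mathcomp Require Import finmap monalg zify ring.
Set Implicit Arguments.
Unset Strict Implicit.
Unset Printing Implicit Defensive.
Import Order.TTheory GRing.Theory Num.Theory.
Local Open Scope ring_scope.

(* Put W(a, b) for the coefficient of z^a w^b in q(z) q(w) (z - w) / (z + w)
   (expanded in powers of w / z), for all integers a, b, and ev(w) for the Pfaffian of the W(w_i, w_j), i < j,
   over a word w of integers (0 appended to odd words), so that Q_l = ev(l).
   Since W(a, b) + W(b, a) = 2 (-1)^a [a + b = 0], ev is a vacuum expectation
   of neutral fermions. For odd n, d/dp_n subtracts n from each letter in turn,
   up to the factor 2/n, and multiplication by p_n is the quadratic operator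
   (1/4) sum_b (-1)^b phi_(n - b) phi_b: both sides of the latter claim have
   the same derivatives by induction on the degree, and no constant term.
   The sum of 2^-l(S) ev_X(S) ev_Y(S) over S moves phi_a acting on X to
   (-1)^a phi_(-a) acting on Y, so d/dp_n(X) multiplies it by (2/n) p_n(Y), as
   it does the Cauchy kernel. Applying T to X only rescales d/dp_n(X). *)

(** * Contractions and Pfaffians of words *)

Lemma leibniz1 (R : nzRingType) (D : {additive R -> R}) :
  (forall x y, D (x * y) = D x * y + x * D y) -> D 1 = 0.
Proof.
move=> DM; apply: (addrI (D 1)).
by rewrite addr0 -[RHS](congr1 D (mulr1 1)) DM mulr1 mul1r.
Qed.

Section Contraction.
Variables (T : Type) (R : comNzRingType) (W : T -> T -> R).
Implicit Types (a b c : T) (u v w : seq T) (f g : seq T -> R).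

(* The alternating sum of W a c * f (v without c) over the letters c of v. *)
Fixpoint contr a f v : R :=
  if v is c :: v' then W a c * f v' - contr a (fun u => f (c :: u)) v' else 0.

Lemma eq_contr a f g v : f =1 g -> contr a f v = contr a g v.
Proof.
by elim: v f g => //= c v IHv f g fg; rewrite fg (IHv _ (fun u => g (c :: u))).
Qed.

Lemma contr_lin a k f g v :
  contr a (fun u => k * f u + g u) v = k * contr a f v + contr a g v.
Proof.
elim: v f g => [|c v IHv] f g /=; first by ring.
by rewrite IHv; ring.
Qed.

Lemma contrD a f g v : contr a (fun u => f u + g u) v = contr a f v + contr a g v.
Proof.
by rewrite -[contr a f v]mul1r -(contr_lin a 1 f); apply: eq_contr => u; rewrite mul1r.
Qed.

Lemma contr0 a v : contr a (fun=> 0) v = 0.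
Proof. by elim: v => //= c v ->; ring. Qed.

Lemma contrZ a k f v : contr a (fun u => k * f u) v = k * contr a f v.
Proof.
rewrite -[RHS]addr0 -[X in _ + X](contr0 a v) -(contr_lin a k f).
by apply: eq_contr => u; rewrite addr0.
Qed.

Lemma contr_affine a k f g v :
  contr a (fun u => k * f u - g u) v = k * contr a f v - contr a g v.
Proof.
elim: v f g => [|c v IHv] f g /=; first by ring.
by rewrite IHv; ring.
Qed.

Lemma contr_anti a b f v : contr a (contr b f) v = - contr b (contr a f) v.
Proof.
elim: v f => [|c v IHv] f /=; first by rewrite oppr0.
by rewrite !contr_affine IHv; ring.
Qed.

Lemma contr_left0 a f v : (forall b, W a b = 0) -> contr a f v = 0.
Proof. by move=> W0; elim: v f => //= c v IHv f; rewrite W0 IHv; ring. Qed.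

Lemma contr_rcons0 a b f v : (forall c, W c b = 0) ->
  (forall u, f (rcons u b) = 0) -> contr a f (rcons v b) = 0.
Proof.
move=> Wb; elim: v f => [|c v IHv] f f0 /=; first by rewrite Wb; ring.
by rewrite f0 IHv; [ring | move=> u; rewrite -rcons_cons f0].
Qed.

Lemma contr_swap a b c k f g u v :
  (forall u v, f (u ++ a :: b :: v) + f (u ++ b :: a :: v) = k * g (u ++ v)) ->
  contr c f (u ++ a :: b :: v) + contr c f (u ++ b :: a :: v)
  = k * contr c g (u ++ v).
Proof.
elim: u f g => [|d u IHu] f g fg /=.
  have /(eq_contr c) := fun v' => fg [::] v'.
  move=> /(_ v) /=; rewrite contrD contrZ => <-; ring.
transitivity (W c d * (k * g (u ++ v)) -
  k * contr c (fun w => g (d :: w)) (u ++ v)); last by ring.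
by rewrite -fg -(IHu (fun w => f (d :: w))) => [|u' v']; [ring | apply: (fg (d :: u'))].
Qed.

(* The Pfaffian of (W (w i) (w j)), i < j, expanded along the first row,
   where w has 2n letters. *)
Fixpoint pfw n (w : seq T) : R :=
  match n, w with
  | 0%N, [::] => 1
  | n'.+1, a :: v => contr a (pfw n') v
  | _, _ => 0
  end.

#[local] Arguments pfw n w : simpl nomatch.

Lemma pfw_swap n a b u v :
  pfw n.+1 (u ++ a :: b :: v) + pfw n.+1 (u ++ b :: a :: v)
  = (W a b + W b a) * pfw n (u ++ v).
Proof.
have pf0 u' x v' : pfw 0 (u' ++ x :: v') = 0 by case: u'.
elim: n u v => [|n IHn] [|c u] v /=.
- by rewrite !contr0; ring.
- rewrite mulr0 -[RHS](mul0r (contr c (fun=> 0) (u ++ v))).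
  by apply: contr_swap => u' v'; rewrite !pf0; ring.
- by rewrite (contr_anti a b); ring.
- exact: contr_swap.
Qed.

Lemma pfw_rcons0 n b u : (forall c, W c b = 0) -> pfw n (rcons u b) = 0.
Proof.
move=> Wb; elim: n u => [|n IHn] [|a u] //=.
exact: contr_rcons0.
Qed.

Lemma pfw_left0 n a v : (forall b, W a b = 0) -> pfw n (a :: v) = 0.
Proof. by case: n => //= n; apply: contr_left0. Qed.

Lemma pfw_ind (P : seq T -> R -> Prop) :
    P [::] 1 -> (forall w, P w 0) -> (forall w x y, P w x -> P w y -> P w (x + y)) ->
    (forall w x, P w x -> P w (- x)) ->
    (forall a b v w x, P (v ++ w) x -> P (a :: v ++ b :: w) (W a b * x)) ->
  forall n w, P w (pfw n w).
Proof.
move=> P1 P0 PD PN PW; elim=> [|n IHn] [|a v] //=.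
have : forall u, P (rev [::] ++ u) (pfw n u) by [].
rewrite -[a :: v]/(a :: rev [::] ++ v).
elim: v [::] (pfw n) => [|c v IHv] s f Pf /=; first exact: P0.
apply: PD; first exact: PW.
apply: PN; rewrite -cat_rcons -rev_cons; apply: IHv => u.
by rewrite rev_cons cat_rcons.
Qed.

End Contraction.

Section Shift.
Variables (T : Type) (R : comNzRingType) (sh : T -> T).
Implicit Types (a b c : T) (u v w : seq T) (f g : seq T -> R).

Fixpoint wshift f w : R :=
  if w is a :: v then f (sh a :: v) + wshift (fun u => f (a :: u)) v else 0.

Lemma eq_wshift f g w : f =1 g -> wshift f w = wshift g w.
Proof.
elim: w f g => //= a w IHw f g fg.
by rewrite fg (IHw _ (fun u => g (a :: u))).
Qed.

Lemma wshift_lin k f g w :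
  wshift (fun u => k * f u - g u) w = k * wshift f w - wshift g w.
Proof.
elim: w f g => [|a w IHw] f g /=; first by ring.
by rewrite IHw; ring.
Qed.

Lemma wshiftZ k f w : wshift (fun u => k * f u) w = k * wshift f w.
Proof.
elim: w f => [|a w IHw] f /=; first by ring.
by rewrite IHw; ring.
Qed.

Lemma wshift_contr W a f v :
  wshift (contr W a f) v =
  contr (fun b c => W b (sh c)) a f v + contr W a (wshift f) v.
Proof.
elim: v f => [|c v IHv] f /=; first by rewrite addr0.
rewrite wshift_lin IHv contrD; ring.
Qed.

Section Derivation.
Variables (W : T -> T -> R) (D : {additive R -> R}) (k : R).
Hypothesis DM : forall x y, D (x * y) = D x * y + x * D y.
Hypothesis DW : forall a b, D (W a b) = k * (W (sh a) b + W a (sh b)).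

Lemma contr_deriv a f g v : (forall u, D (f u) = k * g u) ->
  D (contr W a f v) = k * (contr W (sh a) f v +
    contr (fun b c => W b (sh c)) a f v + contr W a g v).
Proof.
elim: v f g => [|c v IHv] f g fg /=; first by rewrite raddf0; ring.
rewrite raddfB /= DM DW fg (IHv _ (fun u => g (c :: u))) //; ring.
Qed.

Lemma pfw_deriv n w : D (pfw W n w) = k * wshift (pfw W n) w.
Proof.
have D1 := leibniz1 DM; elim: n w => [|n IHn] [|a v] /=; rewrite ?raddf0 ?D1 ?mulr0 //.
  rewrite add0r.
  by elim: v => [|c v IHv] /=; rewrite ?addr0 ?mulr0 ?add0r.
by rewrite (contr_deriv _ _ IHn) wshift_contr addrA.
Qed.

End Derivation.
End Shift.

Lemma pfw_morph (T : Type) (R S : comNzRingType) (h : {rmorphism R -> S})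
  (W : T -> T -> R) n w : h (pfw W n w) = pfw (fun a b => h (W a b)) n w.
Proof.
elim: n w => [|n IHn] [|a v] /=; rewrite ?rmorph0 ?rmorph1 //.
have {}IHn : forall u, h (pfw W n u) = pfw (fun a b => h (W a b)) n u by [].
move: (pfw W n) (pfw (fun a b => h (W a b)) n) IHn => f g fg.
elim: v f g fg => [|c v IHv] f g fg /=; first exact: rmorph0.
by rewrite rmorphB rmorphM /= fg (IHv _ (fun u => g (c :: u))).
Qed.

(** * Functionals on words with Clifford relations *)

Section Clifford.
Variable R : comNzRingType.
Implicit Types (a b c : int) (u v w : seq int) (f g : seq int -> R).

Definition asign a : R := (-1) ^+ `|a|%N.

Lemma asignD a b : asign (a + b) = asign a * asign b.
Proof.
rewrite /asign -exprD -signr_odd -[in RHS]signr_odd; congr ((-1) ^+ nat_of_bool _).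
by lia.
Qed.

Lemma asignN a : asign (- a) = asign a.
Proof. by rewrite /asign abszN. Qed.

Lemma asignV a : asign a * asign a = 1.
Proof. by rewrite /asign -exprD -signr_odd addnn odd_double. Qed.

Lemma asign_odd (n : nat) : odd n -> asign n = -1.
Proof. by move=> on; rewrite /asign absz_nat -signr_odd on. Qed.

Lemma asignB a b : asign (a - b) = asign a * asign b.
Proof. by rewrite asignD asignN. Qed.

Definition braket a b : R := if a + b == 0 then 2%:R * asign a else 0.

(* Letters act on the vacuum on their right: the generators satisfy
   a b + b a = 2 (-1)^a [a + b = 0], negative ones kill the vacuum and 0
   fixes it. *)
Record clifford f : Prop := Clifford {
  cliffE a b u v :
    f (u ++ a :: b :: v) + f (u ++ b :: a :: v) = braket a b * f (u ++ v);
  cliff_vac u b : b < 0 -> f (rcons u b) = 0;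
  cliff0 u : f (rcons u 0) = f u }.

Lemma cliff_swap f a b u v : clifford f ->
  f (u ++ a :: b :: v) = braket a b * f (u ++ v) - f (u ++ b :: a :: v).
Proof. by move=> cf; rewrite -(cliffE cf) addrK. Qed.

Lemma cliff_morph (S : comNzRingType) (h : {rmorphism S -> R})
    (f : seq int -> S) :
  (forall a b u v, f (u ++ a :: b :: v) + f (u ++ b :: a :: v) =
     (if a + b == 0 then 2%:R * (-1) ^+ `|a|%N else 0) * f (u ++ v)) ->
  (forall u b, b < 0 -> f (rcons u b) = 0) ->
  (forall u, f (rcons u 0) = f u) -> clifford (h \o f).
Proof.
move=> fE fv f0; split=> [a b u v|u b b0|u] /=.
- rewrite -rmorphD fE rmorphM /braket; case: eqP => _; last by rewrite rmorph0.
  by rewrite rmorphM /= rmorph_sign rmorph_nat.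
- by rewrite fv // rmorph0.
- by rewrite f0.
Qed.

Lemma cliff_neg f a u w : clifford f ->
  a < 0 -> all (fun b => a + b < 0) w -> f (u ++ a :: w) = 0.
Proof.
move=> cf a0; elim: w u => [|b w IHw] u /=.
  by rewrite cats1 (cliff_vac cf).
case/andP=> ab /IHw H; rewrite (cliff_swap _ _ _ _ cf) /braket lt_eqF // mul0r.
by rewrite -cat_rcons H subr0.
Qed.

Lemma sum_delta (L c : int) (k : nat) (x : int -> R) : L <= c < L + k%:Z ->
  \sum_(i < k) (if L + i%:Z == c then x (L + i%:Z) else 0) = x c.
Proof.
move=> Lc; have lti : (`|c - L| < k)%N by lia.
rewrite (bigD1 (Ordinal lti)) //= [X in _ + X]big1 => [|i /eqP ni].
  by rewrite addr0 ifT; [congr (x _); lia | lia].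
by case: eqP => // E; case: ni; apply: val_inj => /=; lia.
Qed.

Lemma sum_shift (L : int) (k m : nat) (h : int -> R) :
  \sum_(i < k) (h (L + i%:Z) - h (L + i%:Z - m%:Z)) =
  \sum_(j < m) (h (L + k%:Z - 1 - j%:Z) - h (L - 1 - j%:Z)).
Proof.
elim: m => [|m IHm].
  by rewrite big_ord0 big1 // => i _; rewrite subr0 subrr.
rewrite big_ord_recr /= -IHm.
have -> : h (L + k%:Z - 1 - m%:Z) - h (L - 1 - m%:Z) =
    \sum_(i < k) (h (L + i%:Z - m%:Z) - h (L + i%:Z - m.+1%:Z)).
  elim: k {IHm} => [|k IHk].
    by rewrite big_ord0 addr0 subrr.
  rewrite big_ord_recr /= -IHk.
  have -> : L + k.+1%:Z - 1 - m%:Z = L + k%:Z - m%:Z by lia.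
  have -> : L + k%:Z - m.+1%:Z = L + k%:Z - 1 - m%:Z by lia.
  ring.
by rewrite -big_split /=; apply: eq_bigr => i _; ring.
Qed.

Section Bilinear.
Variables (n M : nat).
Hypotheses (on : odd n) (leM : (n <= M)%N).

Let L : int := n%:Z - M%:Z.
Let k : nat := (M + M - n).+1.

(* Up to the factor 1/4, the modes of the current: up raises the degree by n
   and down lowers it by n. All their letters are bounded by M. *)
Definition up f w : R :=
  \sum_(i < k) asign (L + i%:Z) * f (n%:Z - (L + i%:Z) :: L + i%:Z :: w).

Definition down f u w : R := \sum_(i < k)
  asign (L + i%:Z - n%:Z) * f (u ++ - (L + i%:Z) :: L + i%:Z - n%:Z :: w).

Lemma down_cat f u w : clifford f -> all (fun a => L <= a <= M%:Z) w ->
  down f u w =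
  4%:R * wshift (fun a => a - n%:Z) (fun v => f (u ++ v)) w + down f (u ++ w) [::].
Proof.
move=> cf; elim: w u => [|a w IHw] u /=; first by rewrite mulr0 add0r cats0.
case/andP=> La Lw; rewrite mulrDr -addrA -[u ++ a :: w]cat_rcons.
have -> : wshift (fun b => b - n%:Z) (fun v => f (u ++ a :: v)) w =
    wshift (fun b => b - n%:Z) (fun v => f (rcons u a ++ v)) w.
  by apply: eq_wshift => v; rewrite cat_rcons.
rewrite -IHw //.
pose F c := 2%:R * f (u ++ - c :: w).
pose G c := 2%:R * f (u ++ c - n%:Z :: w).
have -> : 4%:R * f (u ++ a - n%:Z :: w) = F (n%:Z - a) + G a.
  by rewrite /F /G opprB; ring.
rewrite -(@sum_delta L (n%:Z - a) k) ?/L ?/k; last by rewrite /L in La; lia.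
rewrite -(@sum_delta L a k) ?/L ?/k; last by rewrite /L in La; lia.
rewrite /down -!big_split /=; apply: eq_bigr => i _; rewrite -/L.
set c := L + i%:Z.
have /= := cliff_swap (c - n%:Z) a (rcons u (- c)) w cf.
rewrite !cat_rcons => ->.
have /= -> := cliff_swap (- c) a u (c - n%:Z :: w) cf.
have -> : braket (c - n%:Z) a = if c == n%:Z - a then 2%:R * asign (c - n%:Z) else 0.
  by rewrite /braket; congr (if _ then _ else _); lia.
have -> : braket (- c) a = if c == a then 2%:R * asign c else 0.
  by rewrite /braket asignN; congr (if _ then _ else _); lia.
have /asign_odd sn := on.
have sc := asignV c.
have E1 x : asign (c - n%:Z) * (2%:R * asign (c - n%:Z) * x) = 2%:R * x.
  by rewrite mulrA mulrCA asignV mulr1.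
have E2 x : asign (c - n%:Z) * (2%:R * asign c * x) = - (2%:R * x).
  rewrite asignB sn; transitivity (- (2%:R * (asign c * asign c) * x)); first ring.
  by rewrite sc; ring.
case: (c =P n%:Z - a) => _; case: (c =P a) => _;
  rewrite ?mul0r ?sub0r ?mulrBr ?mulrN ?opprB ?opprK ?mulrDr ?E1 ?E2 /F /G; ring.
Qed.

Lemma down_vac f u : clifford f -> (0 < n)%N -> down f u [::] = 0.
Proof.
move=> cf n0; apply: big1 => i _; set c := L + _.
have [cn|cn] := ltP (c - n%:Z) 0.
  by rewrite -[_ ++ _]/(u ++ [:: - c] ++ _) catA cats1 (cliff_vac cf) // mulr0.
rewrite (cliff_swap _ _ _ _ cf) /braket ifF; last by lia.
rewrite -cat_rcons cats1 (cliff_vac cf) ?mulr0; last by lia.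
by rewrite subr0 mul0r mulr0.
Qed.

Lemma downE f w : clifford f -> (0 < n)%N -> all (fun a => L <= a <= M%:Z) w ->
  down f [::] w = 4%:R * wshift (fun a => a - n%:Z) f w.
Proof. by move=> cf n0 Lw; rewrite down_cat // down_vac // addr0. Qed.

Lemma up_deriv (D : {additive R -> R}) (m : nat) (k' : R) f w :
  clifford f -> odd m -> (forall v, D (f v) = k' * wshift (fun a => a - m%:Z) f v) ->
  all (fun a => a <= M%:Z - n%:Z) w ->
  D (up f w) = k' * (wshift (fun a => a - m%:Z) (up f) w +
                     (if n == m then 2%:R * m%:R * f w else 0)).
Proof.
move=> cf om Df lew.
have shE : wshift (fun a => a - m%:Z) (up f) w = \sum_(i < k)
    asign (L + i%:Z) * wshift (fun a => a - m%:Z)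
      (fun v => f (n%:Z - (L + i%:Z) :: L + i%:Z :: v)) w.
  suff H (h : int -> seq int -> R) : wshift (fun a => a - m%:Z)
      (fun v => \sum_(i < k) asign (L + i%:Z) * h (L + i%:Z) v) w =
      \sum_(i < k) asign (L + i%:Z) * wshift (fun a => a - m%:Z) (h (L + i%:Z)) w.
    exact: (H (fun c v => f (n%:Z - c :: c :: v))).
  elim: {lew} w h => [|a w IHw] h /=.
    by rewrite big1 // => i _; rewrite mulr0.
  rewrite (IHw (fun c v => h c (a :: v))) -big_split.
  by apply: eq_bigr => i _ /=; rewrite mulrDr.
pose h c := asign c * f (n%:Z - m%:Z - c :: c :: w).
rewrite /up raddf_sum /=.
under eq_bigr => i _.
  rewrite raddfMsign -/(asign _) Df /=.
  over.
have -> : (if n == m then 2%:R * m%:R * f w else 0) =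
    \sum_(i < k) (h (L + i%:Z) - h (L + i%:Z - m%:Z)).
  rewrite sum_shift.
  have -> : L + k%:Z - 1 = M%:Z by rewrite /L /k; lia.
  have hN j : h (L - 1 - j%:Z) = 0.
    rewrite /h; set c := _ - j%:Z.
    have /= -> := @cliff_neg f c [:: n%:Z - m%:Z - c] w cf; first exact: mulr0.
      by rewrite /c /L; lia.
    by apply/allP => b /(allP lew); rewrite /c /L; lia.
  have hP (j : 'I_m) : h (M%:Z - j%:Z) = if n == m then 2%:R * f w else 0.
    rewrite /h; set c := _ - _.
    have /= -> := cliff_swap (n%:Z - m%:Z - c) c [::] w cf.
    have /= -> := @cliff_neg f (n%:Z - m%:Z - c) [:: c] w cf; last 2 first.
    - by rewrite /c /L; have := ltn_ord j; lia.
    - by apply/allP => b /(allP lew); rewrite /c /L; have := ltn_ord j; lia.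
    rewrite subr0 /braket.
    have -> : n%:Z - m%:Z - c + c == 0 = (n == m) by lia.
    case: eqP => [->|_]; last by rewrite mul0r mulr0.
    by rewrite subrr sub0r asignN mulrA mulrCA asignV mulr1.
  under eq_bigr => j _ do rewrite hN hP subr0.
  rewrite sumr_const card_ord; case: eqP => _; last by rewrite mul0rn.
  by rewrite -[RHS]mulr_natr mulrAC.
rewrite shE -big_split big_distrr /=; apply: eq_bigr => i _.
set c := L + _; rewrite /h asignB (asign_odd om).
have -> : n%:Z - c - m%:Z = n%:Z - m%:Z - c by ring.
have -> : n%:Z - m%:Z - (c - m%:Z) = n%:Z - c by ring.
ring.
Qed.

End Bilinear.
End Clifford.

(** * The Casimir sum over strict partitions *)

Fixpoint swords (N : nat) : seq (seq nat) :=
  if N is N'.+1 then swords N' ++ [seq N :: w | w <- swords N'] else [:: [::]].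

Definition zword (w : seq nat) : seq int := [seq i%:Z | i <- w].

Section Casimir.
Variables (R : comNzRingType) (half : R).
Hypothesis halfE : 2%:R * half = 1.
Implicit Types (a b c : int) (u v w : seq int) (f g : seq int -> R).

Fixpoint casimir f g N u v : R :=
  if N is N'.+1 then
    casimir f g N' u v + half * casimir f g N' (rcons u N%:Z) (rcons v N%:Z)
  else f u * g v.

Lemma casimirC f g N u v : casimir f g N u v = casimir g f N v u.
Proof.
elim: N u v => [|N IHN] u v /=; first exact: mulrC.
by rewrite (IHN u) (IHN (rcons u _)).
Qed.

Lemma casimir_sum f g N u v : casimir f g N u v =
  \sum_(w <- swords N) half ^+ size w * (f (u ++ zword w) * g (v ++ zword w)).
Proof.
elim: N u v => [|N IHN] u v /=; first by rewrite big_seq1 !cats0 mul1r.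
rewrite big_cat big_map !IHN /= big_distrr /=; congr (_ + _).
by apply: eq_bigr => w _; rewrite /= exprS !cat_rcons mulrA.
Qed.

Lemma casimir_swapl f g N a b u u' v : clifford f ->
  casimir f g N (u ++ a :: b :: u') v =
  braket R a b * casimir f g N (u ++ u') v - casimir f g N (u ++ b :: a :: u') v.
Proof.
move=> cf; elim: N u' v => [|N IHN] u' v /=.
  by rewrite (cliff_swap _ _ _ _ cf); ring.
by rewrite !rcons_cat /= !IHN; ring.
Qed.

Lemma casimir_swapr f g N a b u v v' : clifford g ->
  casimir f g N u (v ++ a :: b :: v') =
  braket R a b * casimir f g N u (v ++ v') - casimir f g N u (v ++ b :: a :: v').
Proof. by move=> cg; rewrite casimirC casimir_swapl // !(casimirC g). Qed.

Lemma casimir_vac f g N a u v : clifford g ->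
  a + N%:Z < 0 -> casimir f g N u (rcons v a) = 0.
Proof.
move=> cg; elim: N u v => [|N IHN] u v /= aN.
  by rewrite (cliff_vac cg) ?mulr0 //; lia.
rewrite IHN ?add0r; last by lia.
rewrite -!cats1 -catA /= casimir_swapr // /braket ifF; last by lia.
by rewrite -[v ++ [:: _; _]]cat_rcons !cats1 IHN; [ring | lia].
Qed.

Lemma casimir_adj_top f g N a u v : clifford f -> clifford g -> a = N.+1%:Z ->
  casimir f g N.+1 (rcons u a) v = asign R a * casimir f g N.+1 u (rcons v (- a)).
Proof.
move=> cf cg aN /=; rewrite -aN.
rewrite [casimir _ _ _ u (rcons v (- a))]casimir_vac //; last by lia.
have aa0 w : casimir f g N (rcons (rcons u a) a) w = 0.
  rewrite -cats1 -cats1 -catA /=; set x := casimir _ _ _ _ _.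
  have xN : x = - x.
    by rewrite {1}/x casimir_swapl // /braket ifF ?mul0r ?sub0r //; lia.
  transitivity (half * (x + x)); last by rewrite {2}xN subrr mulr0.
  by transitivity (2%:R * half * x); [rewrite halfE mul1r | ring].
rewrite aa0 -!cats1 -catA /= casimir_swapr // cats0.
rewrite /braket addNr eqxx asignN -[v ++ [:: a; _]]cat_rcons !cats1 casimir_vac //; last first.
  by lia.
rewrite subr0 mulr0 addr0 add0r.
transitivity ((2%:R * half) * (asign R a * asign R a) *
  casimir f g N (rcons u a) v); last by ring.
by rewrite halfE asignV; ring.
Qed.

Lemma casimir_adj f g N a u v : clifford f -> clifford g -> (`|a|%N <= N)%N ->
  casimir f g N (rcons u a) v = asign R a * casimir f g N u (rcons v (- a)).
Proof.
move=> cf cg; elim: N f g cf cg a u v => [|N IHN] f g cf cg a u v leaN.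
  have -> : a = 0 by lia.
  by rewrite /= oppr0 (cliff0 cf) (cliff0 cg) /asign mul1r.
have [aN|aN] := leqP `|a|%N N.
  rewrite /= IHN // -!cats1 -!catA /= casimir_swapl // casimir_swapr //.
  rewrite /braket !ifF; try by lia.
  rewrite -[u ++ [:: _; _]]cat_rcons -[v ++ [:: _; _]]cat_rcons !cats1 IHN //.
  by ring.
have [a0|a0] := leP 0 a.
  have -> : a = N.+1%:Z by lia.
  exact: casimir_adj_top.
have -> : a = - N.+1%:Z by lia.
rewrite opprK casimirC [in RHS]casimirC casimir_adj_top // asignN.
by rewrite mulrA asignV mul1r.
Qed.

Lemma down_up f g (n M : nat) : clifford f -> clifford g -> (n <= M)%N ->
  \sum_(w <- swords M) half ^+ size w * (down n M f [::] (zword w) * g (zword w)) =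
  \sum_(w <- swords M) half ^+ size w * (f (zword w) * up n M g (zword w)).
Proof.
move=> cf cg nM.
transitivity (\sum_(i < (M + M - n).+1) asign R (n%:Z - M%:Z + i%:Z - n%:Z) *
  casimir f g M [:: - (n%:Z - M%:Z + i%:Z); n%:Z - M%:Z + i%:Z - n%:Z] [::]).
  under [RHS]eq_bigr do rewrite casimir_sum big_distrr.
  rewrite exchange_big; apply: eq_bigr => w _ /=.
  by rewrite /down big_distrl big_distrr; apply: eq_bigr => i _ /=; ring.
transitivity (\sum_(i < (M + M - n).+1) asign R (n%:Z - M%:Z + i%:Z) *
  casimir f g M [::] [:: n%:Z - (n%:Z - M%:Z + i%:Z); n%:Z - M%:Z + i%:Z]).
  apply: eq_bigr => i _; have := ltn_ord i; set c := n%:Z - M%:Z + _ => ltik.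
  rewrite -[[:: - c; _]]/(rcons [:: - c] _) casimir_adj //; last by rewrite /c; lia.
  rewrite -[[:: - c]]/(rcons [::] _) casimir_adj //; last by rewrite /c; lia.
  by rewrite asignN mulrA asignV mul1r /= opprK opprB.
under [LHS]eq_bigr do rewrite casimir_sum big_distrr.
rewrite exchange_big; apply: eq_bigr => w _ /=.
by rewrite /up !big_distrr; apply: eq_bigr => i _ /=; ring.
Qed.

End Casimir.

(** * Derivations and homogeneity in polynomial rings *)

Lemma leibniz_sum (R : nzRingType) (D : {additive R -> R}) (S T : Type)
    (r : seq S) (s : seq T) (F : S -> R) (G : T -> R) :
    (forall a b, D (F a * G b) = D (F a) * G b + F a * D (G b)) ->
  D ((\sum_(a <- r) F a) * \sum_(b <- s) G b) =
  D (\sum_(a <- r) F a) * (\sum_(b <- s) G b) +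
  (\sum_(a <- r) F a) * D (\sum_(b <- s) G b).
Proof.
move=> DFG; rewrite (raddf_sum D r) (raddf_sum D s) !big_distrlr /= raddf_sum.
rewrite -big_split; apply: eq_bigr => a _; rewrite raddf_sum -big_split.
by apply: eq_bigr.
Qed.

HB.lock Definition dpring (K : comNzRingType) (I : choiceType) (i : I)
    (f : {pring K[I]}) : {pring K[I]} :=
  \sum_(m <- msupp f) << f@_m *+ m i *g divcm m (ucm i) >>.
Arguments dpring {K I} i f.

Section Derivative.
Variables (K : comNzRingType) (I : choiceType).
Implicit Types (i j : I) (m : {cmonom I}) (f g : {pring K[I]}).

Lemma divcmUK i m : m i != 0%N -> mmul (divcm m (ucm i)) (ucm i) = m.
Proof.
move=> mi; apply/eqP/cmP => j; rewrite cmM divcmE ucmE subnK //.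
by case: eqP => // <-; rewrite lt0n.
Qed.

Lemma dpring_coef i f m : (dpring i f)@_m = f@_(mmul m (ucm i)) *+ (m i).+1.
Proof.
rewrite dpring.unlock raddf_sum /=.
under eq_bigr do rewrite mcoeffU.
set m' := mmul m (ucm i).
have m'i : m' i = (m i).+1 by rewrite cmM cmUU addn1.
have m'K : divcm m' (ucm i) = m.
  by apply/eqP/cmP => j; rewrite divcmE cmM addnK.
case: (msuppP f m') => [m'f|m'f].
  rewrite (bigD1_seq m') ?fset_uniq //= m'K eqxx m'i big1 ?addr0 // => m1 nm1.
  case: eqP => // E; have [/eqP->|/divcmUK E1] := boolP (m1 i == 0%N).
    by rewrite mulr0n.
  by move: nm1; rewrite -E1 E eqxx.
rewrite mul0rn big_seq big1 // => m1 m1f.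
case: eqP => // E; have [/eqP->|/divcmUK E1] := boolP (m1 i == 0%N).
  by rewrite mulr0n.
by move: m1f; rewrite -E1 E (negPf m'f).
Qed.

Lemma dpring_additive i : additive (@dpring K I i).
Proof.
by move=> f g; apply/malgP => m; rewrite mcoeffB !dpring_coef mcoeffB mulrnBl.
Qed.

HB.instance Definition _ i := GRing.isAdditive.Build _ _ (@dpring K I i)
  (dpring_additive i).

Lemma dpringZ i c f : dpring i (c *: f) = c *: dpring i f.
Proof. by apply/malgP => m; rewrite mcoeffZ !dpring_coef mcoeffZ mulrnAr. Qed.

Lemma dpringU i c m : @dpring K I i << c *g m >> = << c *+ m i *g divcm m (ucm i) >>.
Proof.
rewrite dpring.unlock msuppU; case: eqP => [->|_].
  by rewrite big_seq_fset0 mul0rn monalgU0.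
by rewrite big_seq_fset1 mcoeffUU.
Qed.

Lemma pringMU c c' m m' :
  << c *g m >> * << c' *g m' >> = << c * c' *g mmul m m' >> :> {pring K[I]}.
Proof. by rewrite malgM_def fgmulUU. Qed.

Lemma dpringMU i c c' m m'
    (f := << c *g m >> : {pring K[I]}) (g := << c' *g m' >> : {pring K[I]}) :
  @dpring K I i (f * g) = dpring i f * g + f * dpring i g.
Proof.
have -> : dpring i (f * g) =
    << (c * c') *+ (m i + m' i) *g divcm (mmul m m') (ucm i) >>.
  by rewrite pringMU dpringU cmM; reflexivity.
have -> : dpring i f * g = << c *+ m i * c' *g mmul (divcm m (ucm i)) m' >>.
  by rewrite dpringU pringMU; reflexivity.
have -> : f * dpring i g = << c * (c' *+ m' i) *g mmul m (divcm m' (ucm i)) >>.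
  by rewrite dpringU pringMU; reflexivity.
rewrite mulrnDr monalgUD mulrnAl mulrnAr {f g}.
apply: (congr2 (fun x y : {pring K[I]} => x + y)).
  have [/eqP->|mi] := boolP (m i == 0%N); first by rewrite !mulr0n !monalgU0.
  apply: (congr1 (fun k => << _ *g k >>)).
  apply/eqP/cmP => j; rewrite divcmE !cmM divcmE ucmE.
  by case: eqP => [<-|]; lia.
have [/eqP->|mi] := boolP (m' i == 0%N); first by rewrite !mulr0n !monalgU0.
apply: (congr1 (fun k => << _ *g k >>)).
apply/eqP/cmP => j; rewrite divcmE !cmM divcmE ucmE.
by case: eqP => [<-|]; lia.
Qed.

Lemma dpringM i f g : dpring i (f * g) = dpring i f * g + f * dpring i g.
Proof.
rewrite [f]monalgE [g]monalgE.
by apply: (leibniz_sum (D := dpring i)) => m m'; apply: dpringMU.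
Qed.

Lemma dpring_var i j : dpring i (pvar K j) = (i == j)%:R.
Proof.
rewrite pvar.unlock dpringU ucmE eq_sym; case: eqP => [->|_]; last exact: monalgU0.
have -> : divcm (ucm j) (ucm j) = mone; last by [].
by apply/eqP/cmP => k; rewrite divcmE subnn cm1.
Qed.

Lemma cmonom_ind (P : {cmonom I} -> Prop) :
  P mone -> (forall i m, P m -> P (mmul m (ucm i))) -> forall m, P m.
Proof.
move=> P1 PM m; have [n] := ubnP (mdeg m); elim: n m => // n IHn m mn.
have [->|] := eqVneq m mone; first exact: P1.
rewrite -mdeg_eq0 mdegE; case: (finsupp m =P fset0) => [->|/eqP].
  by rewrite big_seq_fset0.
case/fset0Pn => i; rewrite -cmE_neq0 => mi _.
have E := divcmUK mi; rewrite -E; apply: PM; apply: IHn.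
by rewrite -E mdegM mdegU addn1 in mn.
Qed.

Lemma pring_ind (P : {pring K[I]} -> Prop) :
    P 1 -> (forall f g, P f -> P g -> P (f + g)) -> (forall c f, P f -> P (c *: f)) ->
    (forall i f, P f -> P (f * pvar K i)) -> forall f, P f.
Proof.
move=> P1 PD PZ PM f; rewrite (monalgE f).
have P0 : P 0 by rewrite -(scale0r 1); apply: PZ.
elim/big_ind: _ => [|x y Px Py|m _]; [exact: P0 | exact: PD |].
rewrite -scale_mono; apply: PZ.
elim/cmonom_ind: m {f} => [|i m IHm]; first exact: P1.
have -> : << mmul m (ucm i) >> = << m >> * pvar K i :> {pring K[I]}.
  by rewrite pvar.unlock pringMU mulr1; reflexivity.
exact: PM.
Qed.

End Derivative.

Section DerivationAlong.
Variables (K : comNzRingType) (A B : comAlgType K) (h : {lrmorphism A -> B}).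
Variables (d : {additive A -> A}) (D : {additive B -> B}) (c : B).
Hypothesis dM : forall x y, d (x * y) = d x * y + x * d y.
Hypothesis DM : forall x y, D (x * y) = D x * y + x * D y.
Hypothesis dZ : forall k x, d (k *: x) = k *: d x.
Hypothesis DZ : forall k x, D (k *: x) = k *: D x.

Definition related x := D (h x) = c * h (d x).

Lemma related1 : related 1.
Proof.
by rewrite /related rmorph1 (leibniz1 DM) (leibniz1 dM) rmorph0 mulr0.
Qed.

Lemma relatedD x y : related x -> related y -> related (x + y).
Proof. by rewrite /related !raddfD /= => -> ->; rewrite mulrDr. Qed.

Lemma relatedZ k x : related x -> related (k *: x).
Proof. by rewrite /related dZ !linearZ /= DZ => ->; rewrite scalerAr. Qed.

Lemma relatedM x y : related x -> related y -> related (x * y).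
Proof.
by rewrite /related dM rmorphD !rmorphM /= DM => -> ->; ring.
Qed.

End DerivationAlong.

Lemma deriv_psubst (K : comNzRingType) (I J : choiceType) (v : I -> {pring K[J]})
    (j : J) (i : I) (c : {pring K[J]}) :
  (forall l, dpring j (v l) = c * (i == l)%:R) ->
  forall f, dpring j (psubst v f) = c * psubst v (dpring i f).
Proof.
move=> dv f; pose h : {lrmorphism {pring K[I]} -> {pring K[J]}} := psubst v.
change (related h (dpring i) (dpring j) c f); move: f; apply: pring_ind.
- by apply: related1; apply: dpringM.
- exact: relatedD.
- by apply: relatedZ; apply: dpringZ.
move=> l g rg; apply: relatedM; [exact: dpringM | exact: dpringM | exact: rg |].
apply: etrans (congr1 (dpring j) (psubst_var v l)) _; rewrite dv.
apply: (congr1 (fun x => c * x)); apply/esym.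
apply: etrans (congr1 h (dpring_var K i l)) _; exact: rmorph_nat.
Qed.

Section Uniqueness.
Variables (K : fieldType) (I : choiceType).
Hypothesis K0 : [pchar K] =i pred0.

Lemma dpring_eq0 (i : I) (f : {pring K[I]}) m :
  dpring i f = 0 -> f@_m != 0 -> m i = 0%N.
Proof.
move=> df fm; apply/eqP; apply: contraNT fm => mi.
have := congr1 (mcoeff (divcm m (ucm i))) df.
rewrite dpring_coef divcmUK // mcoeff0 -mulr_natl => /eqP.
by rewrite mulf_eq0 ((pcharf0P K).1 K0).
Qed.

Lemma psubst_id (v : I -> {pring K[I]}) f :
  (forall (m : {cmonom I}) i, f@_m != 0 -> m i != 0%N -> v i = pvar K i) -> psubst v f = f.
Proof.
move=> vE; rewrite psubstE /mmap [RHS]monalgE big_seq [RHS]big_seq.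
apply: eq_bigr => m; rewrite -mcoeff_neq0 => fm.
rewrite mul_malgC -scale_mono; congr (_ *: _).
have -> : mmon v m = mmon (pvar K) m.
  rewrite /mmon [LHS]big_seq [RHS]big_seq; apply: eq_bigr => i.
  by rewrite -cmE_neq0 => mi; rewrite (vE m i fm mi).
elim/cmonom_ind: m {fm} => [|i m IHm]; first by rewrite mmorph1.
rewrite mmorphM /= IHm /mmon mdomU big_seq_fset1 cmUU expr1 pvar.unlock.
by rewrite pringMU mulr1; reflexivity.
Qed.

Lemma deriv_uniq (P : pred I) (f : {pring K[I]}) :
  (forall i, P i -> dpring i f = 0) ->
  psubst (fun i => if P i then 0 else pvar K i) f = 0 -> f = 0.
Proof.
move=> df f0; rewrite -[LHS](@psubst_id (fun i => if P i then 0 else pvar K i)) //.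
move=> m i fm mi; case: ifP => // Pi.
by rewrite (dpring_eq0 (df _ Pi) fm) in mi.
Qed.

End Uniqueness.

Section ExpSeries.
Variables (K : fieldType) (R : comAlgType K).
Hypothesis K0 : [pchar K] =i pred0.
Implicit Type f g h : series R.

Lemma mul_seriesCA f g h d :
  mul_series f (mul_series g h) d = mul_series g (mul_series f h) d.
Proof.
have E f1 g1 : mul_series f1 (mul_series g1 h) d =
    \sum_(i < d.+1) \sum_(j < d.+1)
      if (i + j <= d)%N then f1 i * g1 j * h (d - (i + j))%N else 0.
  apply: eq_bigr => i _; rewrite /mul_series big_distrr /=.
  rewrite (@big_ord_widen _ _ _ (d - i).+1 d.+1
    (fun j => f1 i * (g1 j * h (d - i - j)%N))) ?ltnS ?leq_subr //.
  rewrite big_mkcond; apply: eq_bigr => j _.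
  have -> : (j < (d - i).+1)%N = (i + j <= d)%N by have := ltn_ord i; lia.
  by rewrite mulrA subnDA.
rewrite !E exchange_big; apply: eq_bigr => i _; apply: eq_bigr => j _.
by rewrite addnC (mulrC (f _)).
Qed.

Lemma exp_series_widen f d N : f 0%N = 0 -> (d < N)%N ->
  exp_series f d = \sum_(k < N) (k`!%:R^-1 : K) *: pow_series f k d.
Proof.
move=> f0 dN; rewrite /exp_series.
rewrite (big_ord_widen _ (fun k => (k`!%:R^-1 : K) *: pow_series f k d) dN).
rewrite big_mkcond; apply: eq_bigr => k _.
by rewrite ltnS; case: leqP => // dk; rewrite pow_series_lt ?scaler0.
Qed.

Section Derivation.
Variable D : {additive R -> R}.
Hypothesis DM : forall x y, D (x * y) = D x * y + x * D y.
Hypothesis DZ : forall (c : K) x, D (c *: x) = c *: D x.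

Lemma pow_series_deriv f k d :
  D (pow_series f k d) = mul_series (D \o f) (pow_series f k.-1) d *+ k.
Proof.
have D1 := leibniz1 DM; elim: k d => [|k IHk] d.
  by rewrite mulr0n /= /series1; case: eqP => _ /=; rewrite ?D1 ?raddf0.
transitivity (mul_series (D \o f) (pow_series f k) d +
    mul_series f (mul_series (D \o f) (pow_series f k.-1)) d *+ k).
  rewrite /= {1}/mul_series raddf_sum -sumrMnl -big_split; apply: eq_bigr => i _.
  by rewrite /= DM IHk mulrnAr.
rewrite mul_seriesCA mulrS; congr (_ + _).
by case: k {IHk} => [|k]; rewrite ?mulr0n.
Qed.

Lemma exp_series_deriv f d : f 0%N = 0 ->
  D (exp_series f d) = mul_series (D \o f) (exp_series f) d.
Proof.
move=> f0; rewrite (exp_series_widen (N := d.+2)) // raddf_sum big_ord_recl.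
rewrite DZ pow_series_deriv mulr0n scaler0 add0r.
transitivity (\sum_(k < d.+1) (k`!%:R^-1 : K) *:
    mul_series (D \o f) (pow_series f k) d).
  apply: eq_bigr => k _; rewrite DZ pow_series_deriv -scaler_nat scalerA.
  congr (_ *: _); rewrite /bump /= ?add1n factS natrM invfM -mulrA mulrC -mulrA divff.
    by rewrite mulr1.
  by rewrite ((pcharf0P K).1 K0).
rewrite /mul_series; under eq_bigr do rewrite scaler_sumr.
rewrite exchange_big; apply: eq_bigr => i _ /=.
rewrite (exp_series_widen (N := d.+1)) ?ltnS ?leq_subr //.
by rewrite big_distrr; apply: eq_bigr => k _ /=; rewrite scalerAr.
Qed.

End Derivation.

Lemma exp_series_eval0 (S : comAlgType K) (h : {lrmorphism R -> S}) f d :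
  (forall i, h (f i) = 0) -> h (exp_series f d) = (d == 0%N)%:R.
Proof.
move=> hf; rewrite /exp_series raddf_sum big_ord_recl big1 /= => [|i _].
  by rewrite addr0 linearZ /= rmorph_nat fact0 invr1 scale1r.
rewrite linearZ /= /mul_series raddf_sum big1 ?scaler0 // => j _.
by rewrite [LHS]rmorphM /= hf mul0r.
Qed.

End ExpSeries.

Section Homogeneity.
Variables (K : comNzRingType) (I : choiceType) (wt : I -> nat).
Implicit Types (f g : {pring K[I]}) (z : int).

Definition homog z f := forall m, f@_m != 0 -> (wdeg wt m)%:Z = z.

Lemma wdegM m1 m2 : wdeg wt (mmul m1 m2) = (wdeg wt m1 + wdeg wt m2)%N.
Proof.
have E (m : {cmonom I}) (d : {fset I}) : (finsupp m `<=` d)%fset ->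
    wdeg wt m = (\sum_(i <- d) m i * wt i)%N.
  move=> le; rewrite /wdeg (big_fset_incl _ le) // => i _.
  by rewrite -cmE_eq0 => /eqP->.
rewrite (E _ _ (fsubset_refl _)) mdomD.
rewrite (E m1 (finsupp m1 `|` finsupp m2)%fset) ?fsubsetUl //.
rewrite (E m2 (finsupp m1 `|` finsupp m2)%fset) ?fsubsetUr //.
by rewrite -big_split /=; apply: eq_bigr => i _; rewrite cmM mulnDl.
Qed.

Lemma homog0 z : homog z 0.
Proof. by move=> m; rewrite mcoeff0 eqxx. Qed.

Lemma homogD z f g : homog z f -> homog z g -> homog z (f + g).
Proof.
move=> hf hg m; rewrite mcoeffD; have [/eqP E|/hf //] := boolP (f@_m == 0).
by rewrite E add0r => /hg.
Qed.

Lemma homogZ z c f : homog z f -> homog z (c *: f).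
Proof.
move=> hf m; rewrite mcoeffZ => H; apply: hf; apply: contraNneq H => ->.
by rewrite mulr0.
Qed.

Lemma homogN z f : homog z f -> homog z (- f).
Proof. by rewrite -scaleN1r; apply: homogZ. Qed.

Lemma homog_sum z (T : eqType) (r : seq T) (P : pred T) (F : T -> {pring K[I]}) :
  (forall i, i \in r -> P i -> homog z (F i)) -> homog z (\sum_(i <- r | P i) F i).
Proof.
move=> hF; rewrite big_seq_cond; elim/big_ind: _ => [|f g|i /andP[ri Pi]].
- exact: homog0.
- exact: homogD.
- exact: hF.
Qed.

Lemma homogM y z f g : homog y f -> homog z g -> homog (y + z) (f * g).
Proof.
move=> hf hg m; rewrite mcoeff_neq0 => /msuppM_le [m1 [m2]].
case=> m1f m2g ->; rewrite wdegM PoszD hf ?hg // mcoeff_neq0 //.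
Qed.

Lemma homog1 : homog 0 1.
Proof.
move=> m; have [->|/negPf ne] := eqVneq m mone; last by rewrite mcoeff1 ne eqxx.
by rewrite /wdeg mdom1 big_seq_fset0.
Qed.

Lemma homog_var i : homog (wt i) (pvar K i).
Proof.
move=> m; rewrite pvar.unlock mcoeffU1; have [<- _|_] := eqVneq (ucm i) m.
  by rewrite /wdeg mdomU big_seq_fset1 cmUU mul1n.
by rewrite eqxx.
Qed.

Lemma hcomp_homog d (n : nat) f : homog n f ->
  hcomp wt d f = if d == n then f else 0.
Proof.
move=> hf; rewrite /hcomp big_seq_cond; case: eqP => [->|dn].
  rewrite [RHS]monalgE [RHS]big_seq; apply: eq_bigl => m.
  rewrite andb_idr // -mcoeff_neq0 => /hf [->]; exact: eqxx.
apply: big1 => m /andP[]; rewrite -mcoeff_neq0 => /hf [->] /eqP E.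
by case: dn.
Qed.

End Homogeneity.

Lemma homog_psubst (K : comNzRingType) (I J : choiceType) (wI : I -> nat)
    (wJ : J -> nat) (v : I -> {pring K[J]}) z f :
  (forall i, homog wJ (wI i) (v i)) -> homog wI z f -> homog wJ z (psubst v f).
Proof.
move=> hv hf; rewrite psubstE; apply: homog_sum => m; rewrite -mcoeff_neq0 => /hf <- _.
rewrite mul_malgC; apply: homogZ; rewrite /wdeg /mmon.
elim/big_rec2: _ => [|i n x _ hx]; first exact: homog1.
rewrite PoszD; apply: homogM hx; elim: (m i) => [|k IHk]; first exact: homog1.
by rewrite mulSn PoszD exprS; apply: homogM.
Qed.

(** * Row expansion of the Pfaffian *)

Lemma big_lift_perm (V : nmodType) n (i j : 'I_n.+1) (F : 'S_n.+1 -> V) :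
  \sum_(s : 'S_n.+1 | s i == j) F s = \sum_(s : 'S_n) F (lift_perm i j s).
Proof.
pose h (s : 'S_n.+1) := odflt 1%g [pick t : 'S_n | lift_perm i j t == s].
have liftI t : h (lift_perm i j t) = t.
  rewrite /h; case: pickP => [t' /eqP E|/(_ t)]; last by rewrite eqxx.
  apply/permP => k /=; apply: (@lift_inj _ j).
  by rewrite -!(lift_perm_lift i) E.
rewrite (reindex_onto (lift_perm i j) h) => [|s /eqP sij].
  by apply: eq_bigl => t; rewrite lift_perm_id liftI !eqxx.
rewrite /h; case: pickP => [t /eqP //|no].
pose f k := odflt k (unlift j (s (lift i k))).
have liftf k : lift j (f k) = s (lift i k).
  rewrite /f; case: unliftP => [k' -> //|]; rewrite -[RHS]sij => /perm_inj E.
  by have := neq_lift i k; rewrite E eqxx.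
have f_inj : injective f.
  by move=> k1 k2 /(congr1 (lift j)); rewrite !liftf => /perm_inj/lift_inj.
have /eqP[] := no (perm f_inj); apply/permP => k.
case: (unliftP i k) => [k' ->|->]; last by rewrite lift_perm_id.
by rewrite lift_perm_lift permE liftf.
Qed.

Section PfaffianExpansion.
Variables (K : fieldType) (R : comAlgType K).
Hypothesis K0 : [pchar K] =i pred0.

Let pfterm m (A : 'M[R]_(m.*2)) (s : 'S_(m.*2)) : R :=
  (-1) ^+ odd_perm s * \prod_(i < m) A (s (pf_fst i)) (s (pf_snd i)).

Lemma pf_fst_inj m : injective (@pf_fst m).
Proof. by move=> i j /(congr1 val) /double_inj /val_inj. Qed.

Lemma pf_snd_inj m : injective (@pf_snd m).
Proof. by move=> i j /(congr1 val) [] /double_inj /val_inj. Qed.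

Lemma pf_fst_neq_snd m (i j : 'I_m) : pf_fst i != pf_snd j.
Proof. by apply/eqP => /(congr1 (odd \o val)) /=; rewrite !odd_double. Qed.

Section Antisymmetric.
Variables (m : nat) (A : 'M[R]_(m.*2)).
Hypothesis Aanti : forall i j, A i j = - A j i.

Lemma pfterm_pair i j s : i != j ->
  pfterm A ((tperm (pf_fst i) (pf_fst j) * tperm (pf_snd i) (pf_snd j)) * s)%g =
  pfterm A s.
Proof.
move=> ij; rewrite /pfterm !odd_permM !odd_tperm.
rewrite (inj_eq (@pf_fst_inj _)) (inj_eq (@pf_snd_inj _)) ij /=; congr (_ * _).
rewrite (reindex_inj (@perm_inj _ (tperm i j))); apply: eq_bigr => k _ /=.
rewrite !permM; set k' := tperm i j k.
have -> : tperm (pf_fst i) (pf_fst j) (pf_fst k') = pf_fst k.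
  by rewrite /k' (inj_tperm _ _ _ (@pf_fst_inj _)) tpermK.
have -> : tperm (pf_fst i) (pf_fst j) (pf_snd k') = pf_snd k'.
  by rewrite tpermD ?pf_fst_neq_snd.
have -> : tperm (pf_snd i) (pf_snd j) (pf_fst k) = pf_fst k.
  by rewrite tpermD // eq_sym pf_fst_neq_snd.
by rewrite /k' (inj_tperm _ _ _ (@pf_snd_inj _)) tpermK.
Qed.

Lemma pfterm_flip i s : pfterm A (tperm (pf_fst i) (pf_snd i) * s)%g = pfterm A s.
Proof.
rewrite /pfterm odd_permM odd_tperm pf_fst_neq_snd addTb signrN mulNr -mulrN.
rewrite (bigD1 i) //= [in RHS](bigD1 i) //= !permM tpermL tpermR.
rewrite [A (s (pf_snd i)) _]Aanti mulNr opprK; congr (_ * (_ * _)).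
apply: eq_bigr => k ki; rewrite !permM.
have ik : i != k by rewrite eq_sym.
have -> : tperm (pf_fst i) (pf_snd i) (pf_fst k) = pf_fst k.
  by rewrite tpermD ?(inj_eq (@pf_fst_inj _)) // eq_sym pf_fst_neq_snd.
by rewrite tpermD ?(inj_eq (@pf_snd_inj _)) ?pf_fst_neq_snd.
Qed.

Lemma pfterm_row i0 x k :
  \sum_(s : 'S_(m.*2) | s k == x) pfterm A s =
  \sum_(s : 'S_(m.*2) | s (pf_fst i0) == x) pfterm A s.
Proof.
have Efst i : \sum_(s : 'S_(m.*2) | s (pf_fst i) == x) pfterm A s =
    \sum_(s : 'S_(m.*2) | s (pf_fst i0) == x) pfterm A s.
  have [->//|ii0] := eqVneq i i0.
  pose g := (tperm (pf_fst i) (pf_fst i0) * tperm (pf_snd i) (pf_snd i0))%g.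
  rewrite (reindex_inj (mulgI g)); apply: eq_big => [s|s _]; last exact: pfterm_pair.
  by rewrite !permM tpermL tpermD // eq_sym pf_fst_neq_snd.
have [i [->|->]] : exists i, k = pf_fst i \/ k = pf_snd i.
- have lti : (k./2 < m)%N by have := ltn_ord k; lia.
  exists (Ordinal lti); case: (boolP (odd k)) => ok; [right | left];
    by apply: val_inj => /=; lia.
- exact: Efst.
rewrite -(Efst i) (reindex_inj (mulgI (tperm (pf_fst i) (pf_snd i)))).
apply: eq_big => [s|s _]; last exact: pfterm_flip.
by rewrite permM tpermR.
Qed.

Lemma pfterm_sum i0 x : \sum_(s : 'S_(m.*2)) pfterm A s =
  (\sum_(s : 'S_(m.*2) | s (pf_fst i0) == x) pfterm A s) *+ m.*2.
Proof.
rewrite (partition_big (fun s : 'S_(m.*2) => s^-1%g x) xpredT) //=.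
under eq_bigr => k _.
  rewrite (eq_bigl (fun s : 'S_(m.*2) => s k == x)) => [|s]; last first.
    by rewrite eq_sym (canF_eq (permK s)) eq_sym.
  rewrite (pfterm_row i0).
  over.
by rewrite sumr_const card_ord.
Qed.

End Antisymmetric.

Lemma pfaffian_row0 m (A : 'M[R]_(m.+1.*2)) :
  (forall i j, A i j = - A j i) ->
  pfaffian A = \sum_(j < m.*2.+1) (-1) ^+ j * A ord0 (lift ord0 j) *
    pfaffian (\matrix_(x < m.*2, y < m.*2)
                A (lift ord0 (lift j x)) (lift ord0 (lift j y))).
Proof.
move=> Aanti; rewrite /pfaffian -/(pfterm A).
rewrite (pfterm_sum Aanti ord0 ord0) -scalerMnr scalerMnl.
have -> : pf_fst (ord0 : 'I_m.+1) = ord0 :> 'I_(m.*2.+2) by apply: val_inj.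
rewrite (@big_lift_perm _ m.*2.+1 ord0 ord0 (pfterm A)).
rewrite (partition_big (fun s : 'S_(m.*2.+1) => s ord0) xpredT) //=.
rewrite scaler_sumr; apply: eq_bigr => j _.
rewrite big_lift_perm -scalerAr mulr_sumr; congr (_ *: _).
  rewrite -mulr_natr expnS factS -[m.+1.*2]muln2 !natrM.
  have nz (k : nat) : k.+1%:R != 0 :> K by rewrite ((pcharf0P K).1 K0).
  have nz2 : (2 ^ m)%:R != 0 :> K by rewrite ((pcharf0P K).1 K0) expn_eq0.
  have nzf : (m`!)%:R != 0 :> K by rewrite ((pcharf0P K).1 K0) -lt0n fact_gt0.
  by field; rewrite nzf nz2 nat1r nz (nz 1%N).
apply: eq_bigr => t _; rewrite /pfterm !odd_lift_perm /= signr_addb signr_odd.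
rewrite big_ord_recl -!mulrA; congr (_ * _).
have -> : pf_fst (ord0 : 'I_m.+1) = ord0 :> 'I_(m.*2.+2) by apply: val_inj.
have -> : pf_snd (ord0 : 'I_m.+1) = lift ord0 ord0 :> 'I_(m.*2.+2) by apply: val_inj.
rewrite lift_perm_id lift_perm_lift lift_perm_id mulrCA; congr (_ * (_ * _)).
apply: eq_bigr => i _; rewrite mxE.
have -> : pf_fst (lift ord0 i : 'I_m.+1) = lift ord0 (lift ord0 (pf_fst i))
  :> 'I_(m.*2.+2) by apply: val_inj.
have -> : pf_snd (lift ord0 i : 'I_m.+1) = lift ord0 (lift ord0 (pf_snd i))
  :> 'I_(m.*2.+2) by apply: val_inj.
by rewrite !lift_perm_lift.
Qed.

Section Words.
Variables (T : Type) (x0 : T) (W : T -> T -> R).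

Definition skewmx m (w : seq T) : 'M[R]_(m.*2) := \matrix_(i, j)
  if (i < j)%N then W (nth x0 w i) (nth x0 w j)
  else if (j < i)%N then - W (nth x0 w j) (nth x0 w i) else 0.

Lemma contrE a f v : contr W a f v = \sum_(j < size v)
  (-1) ^+ j * W a (nth x0 v j) * f (take j v ++ drop j.+1 v).
Proof.
elim: v f => [|c v IHv] f /=; first by rewrite big_ord0.
rewrite big_ord_recl /= expr0 mul1r drop0 IHv -sumrN; congr (_ + _).
by apply: eq_bigr => j _; rewrite /= exprS mulN1r !mulNr.
Qed.

Lemma pfaffian_pfw m w : size w = m.*2 -> pfaffian (skewmx m w) = pfw W m w.
Proof.
elim: m w => [|m IHm] [|a v] //= sw.
  rewrite /pfaffian (big_pred1 1%g) => [|s]; last by apply/esym/eqP/permP => -[].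
  by rewrite odd_perm1 big_ord0 !mulr1 invr1 scale1r.
have sv : size v = m.*2.+1 by case: sw.
rewrite pfaffian_row0 => [|i j]; last first.
  by rewrite !mxE; case: ltngtP; rewrite ?opprK ?oppr0.
rewrite contrE sv; apply: eq_bigr => j _; rewrite mxE /= -IHm; last first.
  by rewrite size_cat size_takel ?size_drop sv; have := ltn_ord j; lia.
congr (_ * pfaffian _); apply/matrixP => x y; rewrite !mxE /=.
have nthE (z : nat) : nth x0 (take j v ++ drop j.+1 v) z = nth x0 v (bump j z).
  rewrite nth_cat size_takel; last by rewrite sv; have := ltn_ord j; lia.
  rewrite /bump; case: (ltnP z j) => [zj|jz]; first by rewrite add0n nth_take.
  by rewrite nth_drop; congr (nth _ _ _); lia.
rewrite !nthE !add0n.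
have bumpE (z t : nat) : (bump 0 (bump j z) < bump 0 (bump j t))%N = (z < t)%N.
  by rewrite /bump; lia.
by rewrite !bumpE.
Qed.

End Words.
End PfaffianExpansion.

(** * Schur Q-functions of integer words *)

Lemma eq_wshift_size (T : Type) (R : comNzRingType) (sh : T -> T) (f g : seq T -> R) w :
  (forall u, size u = size w -> f u = g u) -> wshift sh f w = wshift sh g w.
Proof.
elim: w f g => //= a w IHw f g fg; rewrite fg //; congr (_ + _).
by apply: IHw => u su; apply: fg; rewrite /= su.
Qed.

Lemma wshift_eq0 (T : Type) (R : comNzRingType) (sh : T -> T) (f : seq T -> R) w :
  (forall u a v, w = u ++ a :: v -> f (u ++ sh a :: v) = 0) -> wshift sh f w = 0.
Proof.
elim: w f => //= a w IHw f f0; rewrite (f0 [::]) // add0r.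
by apply: IHw => u b v E; apply: (f0 (a :: u)); rewrite E.
Qed.

Lemma wshift_rcons (T : Type) (R : comNzRingType) (sh : T -> T) (f : seq T -> R) w a :
  wshift sh f (rcons w a) = wshift sh (fun u => f (rcons u a)) w + f (rcons w (sh a)).
Proof.
elim: w f => [|b w IHw] f /=; first by rewrite addr0 add0r.
by rewrite IHw addrA.
Qed.

Lemma wshift_morph (T : Type) (R S : comNzRingType) (h : {rmorphism R -> S})
    (sh : T -> T) (f : seq T -> R) w :
  h (wshift sh f w) = wshift sh (fun u => h (f u)) w.
Proof.
elim: w f => [|a w IHw] f /=; first exact: rmorph0.
by rewrite rmorphD (IHw (fun u => f (a :: u))).
Qed.

#[local] Arguments pfw : simpl never.

Section Neutral.
Variables (K : fieldType) (R : comAlgType K).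
Hypothesis K0 : [pchar K] =i pred0.
Variables (p : nat -> R) (D : nat -> {additive R -> R}) (ev0 : {lrmorphism R -> R}).
Hypothesis DM : forall i x y, D i (x * y) = D i x * y + x * D i y.
Hypothesis DZ : forall i (c : K) x, D i (c *: x) = c *: D i x.
Hypothesis Dp : forall i n, odd n -> D i (p n) = (i.*2.+1 == n)%:R.
Hypothesis ev0p : forall n, odd n -> ev0 (p n) = 0.
Hypothesis uniqD : forall x, (forall i, D i x = 0) -> ev0 x = 0 -> x = 0.

Definition qexp (r : nat) : R :=
  exp_series (fun n => if odd n then (2%:R / n%:R : K) *: p n else 0) r.

Definition kap i : R := (2%:R / i.*2.+1%:R : K)%:A.

Definition q (z : int) : R := if z is Posz r then qexp r else 0.

Lemma kapE i : kap i * i.*2.+1%:R = 2%:R.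
Proof.
rewrite /kap mulr_algl -[X in _ *: X]scaler_nat scalerA divfK ?scaler_nat //.
by rewrite ((pcharf0P K).1 K0).
Qed.

Lemma q_neg z : z < 0 -> q z = 0.
Proof. by case: z. Qed.

Lemma q_deriv i z : D i (q z) = kap i * q (z - i.*2.+1%:Z).
Proof.
set m := i.*2.+1; case: z => [r|r]; last by rewrite [q (Negz r)]q_neg // raddf0 q_neg ?mulr0 //; lia.
rewrite -[q r]/(qexp r) /qexp exp_series_deriv //.
have om : odd m by rewrite /= odd_double.
have DE n : D i (if odd n then (2%:R / n%:R : K) *: p n else 0) =
    if n == m then kap i else 0.
  case: ifP => on; last by rewrite raddf0; case: eqP => // E; rewrite E om in on.
  rewrite DZ Dp // -/m eq_sym; case: eqP => [->|_]; first by [].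
  by rewrite scaler0.
rewrite /mul_series /=; under eq_bigr do rewrite DE.
have [mr|rm] := leqP m r.
  rewrite (bigD1 (Ordinal (mr : (m < r.+1)%N))) //= eqxx big1 ?addr0 => [|j jm].
    by congr (_ * _); have -> : r%:Z - m%:Z = (r - m)%N by lia.
  by rewrite ifF ?mul0r //; apply: contraNF jm => /eqP jm; apply/eqP/val_inj.
rewrite q_neg ?mulr0; last by lia.
by rewrite big1 // => j _; rewrite ifF ?mul0r //; have := ltn_ord j; lia.
Qed.

Lemma ev0_q z : ev0 (q z) = (z == 0)%:R.
Proof.
case: z => [r|r] /=; last by rewrite raddf0.
rewrite exp_series_eval0 // => n; case: ifP => on; last by rewrite raddf0.
by rewrite linearZ /= ev0p // scaler0.
Qed.

Definition wcoef (k : nat) : R := if k == 0%N then 1 else 2%:R * (-1) ^+ k.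

Definition W (a b : int) : R :=
  if b is Posz b' then
    \sum_(k < b'.+1) wcoef k * (q (a + k%:Z) * q (b - k%:Z))
  else 0.

Lemma W_neg2 a b : b < 0 -> W a b = 0.
Proof. by case: b. Qed.

(* Any upper summation bound will do, since q vanishes at negative integers. *)
Lemma W_widen N a b : b < N%:Z ->
  W a b = \sum_(k < N) wcoef k * (q (a + k%:Z) * q (b - k%:Z)).
Proof.
case: b => [b|b] bN; last first.
  by rewrite [LHS]W_neg2 // big1 // => k _; rewrite [q (_ - _)]q_neg ?mulr0 //; lia.
have le : (b.+1 <= N)%N by lia.
rewrite /W (big_ord_widen _ (fun k => wcoef k * (q (a + k%:Z) * q (b%:Z - k%:Z))) le).
rewrite big_mkcond; apply: eq_bigr => k _; case: ltnP => // bk.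
by rewrite [q (_ - _)]q_neg ?mulr0 //; lia.
Qed.

Lemma W_neg a b : a + b < 0 -> W a b = 0.
Proof.
move=> ab; rewrite (@W_widen `|b|.+1) ?big1 //; last by lia.
move=> k _; have [ak|ak] := ltP (a + k%:Z) 0; first by rewrite q_neg // mul0r mulr0.
by rewrite [q (_ - _)]q_neg ?mulr0 //; lia.
Qed.

Lemma D_sign i k x : D i ((-1) ^+ k * x) = (-1) ^+ k * D i x.
Proof. exact: raddfMsign. Qed.

Lemma D_nat i k x : D i (k%:R * x) = k%:R * D i x.
Proof. by rewrite !mulr_natl raddfMn. Qed.

Lemma D_wcoef i k x : D i (wcoef k * x) = wcoef k * D i x.
Proof.
rewrite /wcoef; case: eqP => _; first by rewrite !mul1r.
by rewrite -!mulrA D_nat D_sign.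
Qed.

Lemma W_deriv i a b :
  D i (W a b) = kap i * (W (a - i.*2.+1%:Z) b + W a (b - i.*2.+1%:Z)).
Proof.
set m := i.*2.+1%:Z.
rewrite !(@W_widen `|b|.+1); try lia.
rewrite raddf_sum /= mulrDr !mulr_sumr -big_split; apply: eq_bigr => k _.
rewrite /= D_wcoef DM !q_deriv -/m.
have -> : a + k%:Z - m = a - m + k%:Z by ring.
have -> : b - k%:Z - m = b - m - k%:Z by ring.
ring.
Qed.

Lemma ev0_W a b : ev0 (W a b) =
  if (a + b == 0) && (0 <= b) then wcoef `|b| else 0.
Proof.
case: b => [b|b]; last by rewrite raddf0 andbF.
rewrite /W raddf_sum /= andbT.
have wE k : ev0 (wcoef k) = wcoef k.
  by rewrite /wcoef; case: eqP => _; rewrite ?rmorph1 // rmorphM /= rmorph_sign rmorph_nat.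
rewrite big_ord_recr big1 /= => [|k _].
  rewrite add0r !rmorphM /= wE !ev0_q subrr eqxx mulr1.
  by case: eqP => _; rewrite ?mulr1 ?mulr0.
rewrite !rmorphM /= !ev0_q [(b%:Z - _ == 0)]negbTE ?mulr0 //.
by have := ltn_ord k; lia.
Qed.

Lemma ev0_W_pos a b : 0 < a -> ev0 (W a b) = 0.
Proof. by move=> a0; rewrite ev0_W ifF //; lia. Qed.

Lemma W_anti a b : W a b + W b a = braket R a b.
Proof.
suff main N : forall a b, a + b < N%:Z -> W a b + W b a = braket R a b.
  by apply: (main `|a + b|.+1); lia.
elim: N => [|N IHN] {}a {}b abN.
  have ba : b + a < 0 by rewrite addrC.
  by rewrite (W_neg abN) (W_neg ba) addr0 /braket ifF //; lia.
apply/eqP; rewrite -subr_eq0; apply/eqP/uniqD => [i|].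
  set m := i.*2.+1%:Z.
  have sm : asign R m = -1 by rewrite asign_odd //= odd_double.
  rewrite raddfB raddfD /= !W_deriv -/m.
  have -> : D i (braket R a b) = 0.
    rewrite /braket; case: eqP => _; last exact: raddf0.
    rewrite mulr_natl raddfMn /= /asign -[(-1) ^+ _]mulr1 D_sign (leibniz1 (DM i)) mulr0.
    by rewrite mul0rn.
  have E1 := IHN (a - m) b; have E2 := IHN a (b - m).
  rewrite subr0 -mulrDr [X in _ * X](_ : _ =
    (W (a - m) b + W b (a - m)) + (W a (b - m) + W (b - m) a)); last by ring.
  rewrite E1 ?E2; try by rewrite /m; lia.
  rewrite /braket [a + (b - m)]addrA [a - m + b]addrAC asignB sm.
  by case: eqP => _; ring.
rewrite raddfB raddfD /= !ev0_W /braket [b + a]addrC.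
case: eqP => [ab|_] /=; last by rewrite raddf0 addr0 subr0.
have -> : a = - b by lia.
rewrite /asign abszN rmorphM /= rmorph_sign rmorph_nat /wcoef absz_eq0.
have -> : (0 <= - b) = (b <= 0) by lia.
by case: (ltgtP b 0) => [b0|b0|->] /=; rewrite ?ltr0_neq0 ?gtr0_neq0 //=; ring.
Qed.

Definition ev (w : seq int) : R :=
  pfw W (uphalf (size w)) (if odd (size w) then rcons w 0 else w).

Lemma ev_cliff : clifford ev.
Proof.
have two x : 2%:R * x = 0 -> x = 0 :> R.
  move=> x2; rewrite -[x](scalerK (a := 2%:R)) ?((pcharf0P K).1 K0) //.
  by rewrite scaler_nat -[x *+ 2]mulr_natl x2 scaler0.
split=> [a b u v|u b b0|u].
- rewrite /ev !size_cat /= !addnS /= negbK.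
  by case: ifP => _; rewrite ?rcons_cat /= pfw_swap W_anti.
- rewrite /ev size_rcons /=; case: ifP => _; last first.
    by apply: pfw_rcons0 => c; apply: W_neg2.
  have := pfw_swap W (size u)./2 b 0 u [::].
  rewrite -!cat_rcons !cats0 W_anti /braket addr0 ifF; last by lia.
  rewrite mul0r [X in _ + X]pfw_rcons0 ?addr0 // => c; exact: W_neg2.
rewrite /ev size_rcons /= if_neg uphalf_half; case: ifP => [ou|eu].
  by rewrite add1n.
rewrite add0n; apply/eqP; rewrite -subr_eq0; apply/eqP/two; rewrite mulrBr.
have := pfw_swap W (size u)./2 0 0 u [::].
rewrite -!cat_rcons !cats0 W_anti /braket addr0 eqxx /asign absz0 expr0 mulr1 => <-.
by ring.
Qed.

Lemma ev_deriv i w : D i (ev w) = kap i * wshift (fun a => a - i.*2.+1%:Z) ev w.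
Proof.
rewrite {1}/ev (pfw_deriv (DM i) (W_deriv i)); congr (_ * _).
have [ow|ew] := ifP; last first.
  by apply: eq_wshift_size => u su; rewrite /ev su ew.
rewrite wshift_rcons [X in _ + X]pfw_rcons0 ?addr0 => [|c]; last by rewrite W_neg2 //; lia.
by apply: eq_wshift_size => u su; rewrite /ev su ow.
Qed.

Lemma pfw_neg n w : \sum_(a <- w) a < 0 -> pfw W n w = 0.
Proof.
apply: (@pfw_ind _ _ W (fun w x => \sum_(a <- w) a < 0 -> x = 0)) => {n w}.
- by rewrite big_nil.
- by [].
- by move=> w x y xw yw w0; rewrite xw // yw // addr0.
- by move=> w x xw w0; rewrite xw // oppr0.
move=> a b v w x; rewrite big_cons !big_cat big_cons /= => xvw w0.
have [ab|ab] := ltP (a + b) 0; first by rewrite W_neg ?mul0r.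
by rewrite xvw ?mulr0 //; lia.
Qed.

Lemma ev_neg w : \sum_(a <- w) a < 0 -> ev w = 0.
Proof.
by move=> w0; apply: pfw_neg; case: ifP => _ //; rewrite -cats1 big_cat big_seq1 /= addr0.
Qed.

Lemma ev0_ev a w : 0 < a -> ev0 (ev (a :: w)) = 0.
Proof.
move=> a0; rewrite /ev pfw_morph; case: ifP => _;
  by apply: pfw_left0 => b; apply: ev0_W_pos.
Qed.

Lemma ev_up n M w : odd n -> (n <= M)%N -> all (fun a => a <= M%:Z - n%:Z) w ->
  up n M ev w = 4%:R * (p n * ev w).
Proof.
move=> on nM; have cev := ev_cliff.
suff main N : forall w : seq int, \sum_(a <- w) a + n%:Z < N%:Z ->
    all (fun a => a <= M%:Z - n%:Z) w -> up n M ev w = 4%:R * (p n * ev w).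
  by apply: (main `|\sum_(a <- w) a + n%:Z|.+1); set x := \sum_(a <- w) a; lia.
elim: N => [|N IHN] {}w wN leM.
  set x := \sum_(a <- w) a in wN.
  rewrite [ev w]ev_neg ?mulr0; last by rewrite -/x; lia.
  rewrite /up big1 // => j _; rewrite ev_neg ?mulr0 //.
  by rewrite !big_cons -/x; lia.
apply/eqP; rewrite -subr_eq0; apply/eqP/uniqD => [i|].
  set m := i.*2.+1; have om : odd m by rewrite /= odd_double.
  rewrite raddfB /= (up_deriv on nM cev om (ev_deriv i) leM).
  rewrite D_nat DM Dp // ev_deriv -/m.
  transitivity (kap i * wshift (fun a => a - m%:Z) (fun w => 1 * up n M ev w -
      4%:R * (p n * ev w)) w + (if m == n then kap i * (2%:R * m%:R) * ev w else 0) -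
      4%:R * (if m == n then 1 else 0) * ev w).
    rewrite wshift_lin.
    have -> : wshift (fun a => a - m%:Z) (fun w => 4%:R * (p n * ev w)) w =
        4%:R * (p n * wshift (fun a => a - m%:Z) ev w).
      by rewrite !wshiftZ.
    by rewrite [n == m]eq_sym; case: eqP => _ /=; ring.
  rewrite wshift_eq0 => [|u a v E].
    rewrite mulrCA kapE; case: eqP => _; ring.
  apply/eqP; rewrite mul1r subr_eq0; apply/eqP/IHN.
    move: wN; rewrite E !big_cat !big_cons /= /m; lia.
  by move: leM; rewrite E !all_cat /= => /and3P[-> al ->]; rewrite andbT; lia.
rewrite raddfB /= !rmorphM /= ev0p // mul0r mulr0 subr0 raddf_sum big1 // => j _.
rewrite [LHS]rmorphM /=; set c := n%:Z - M%:Z + _.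
have [c0|c0] := ltP 0 (n%:Z - c); first by rewrite ev0_ev ?mulr0.
have /= -> := cliff_swap (n%:Z - c) c [::] w cev.
rewrite /braket ifF; last by case: (n) on => //; lia.
by rewrite mul0r sub0r raddfN /= ev0_ev ?oppr0 ?mulr0 //; case: (n) on c0 => //; lia.
Qed.

Section TwoAlphabets.
Variables (R2 : comAlgType K) (hX hY : {lrmorphism R -> R2}).
Variables (DX : nat -> {additive R2 -> R2}) (phi : {lrmorphism R2 -> R2}).
Variables (rr : nat -> K) (ker : series R2).
Hypothesis DXM : forall i x y, DX i (x * y) = DX i x * y + x * DX i y.
Hypothesis DXZ : forall i (c : K) x, DX i (c *: x) = c *: DX i x.
Hypothesis DXhX : forall i x, DX i (hX x) = rr i *: hX (D i x).
Hypothesis DXhY : forall i x, DX i (hY x) = 0.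
Hypothesis phiX : forall x, ev0 x = 0 -> phi (hX x) = 0.
Hypothesis uniqX : forall x, (forall i, DX i x = 0) -> phi x = 0 -> x = 0.
Hypothesis ker0 : ker 0%N = 0.
Hypothesis DXker : forall i k, DX i (ker k) =
  if k == (i.*2.+1).*2 then (rr i)%:A * hX (kap i) * hY (p i.*2.+1) else 0.
Hypothesis phi_ker : forall k, phi (ker k) = 0.

Definition onehalf : R2 := (2%:R^-1 : K)%:A.

Lemma onehalfE : 2%:R * onehalf = 1.
Proof.
rewrite /onehalf mulr_natl -scaler_nat scalerA divff ?scale1r //.
by rewrite ((pcharf0P K).1 K0).
Qed.

Definition cauchy (M d : nat) : R2 := \sum_(w <- swords M | sumn w == d)
  onehalf ^+ size w * (hX (ev (zword w)) * hY (ev (zword w))).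

Let f (w : seq int) : R2 := hX (ev w).
Let g (d : nat) (w : seq int) : R2 := if \sum_(a <- w) a == d%:Z then hY (ev w) else 0.

Lemma cliff_f : clifford f.
Proof.
by have [fE fv f0] := ev_cliff; apply: (cliff_morph hX).
Qed.

Lemma cliff_g d : clifford (g d).
Proof.
have [fE fv f0] := ev_cliff.
have [hE hv h0] : clifford (hY \o ev).
  exact: (cliff_morph hY).
split=> [a b u v|u b b0|u]; rewrite /g.
- rewrite !big_cat !big_cons /=.
  set x := \sum_(a <- u) a; set y := \sum_(a <- v) a.
  have -> : x + (b + (a + y)) = x + (a + (b + y)) by ring.
  case: eqP => [E|nE]; last first.
    rewrite addr0 /braket; case: eqP => [ab|_]; last by rewrite mul0r.
    by rewrite ifF ?mulr0 //; apply/eqP => E; apply: nE; lia.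
  rewrite hE /braket; case: eqP => [ab|_]; last by rewrite !mul0r.
  by rewrite ifT //; lia.
- by have /= -> := hv u b b0; rewrite if_same.
by have /= -> := h0 u; rewrite -cats1 big_cat big_seq1 /= addr0.
Qed.

Lemma zword_sum w : \sum_(a <- zword w) a = (sumn w)%:Z.
Proof. by elim: w => [|n w IHw]; rewrite ?big_nil // big_cons IHw. Qed.

Lemma mem_swords M w i : w \in swords M -> i \in w -> (0 < i <= M)%N.
Proof.
elim: M w => [|M IHM] w /=; first by rewrite inE => /eqP->.
rewrite mem_cat => /orP[/IHM H /H|/mapP[w' /IHM H ->]]; first by lia.
by rewrite inE => /predU1P[->|/H]; lia.
Qed.

Lemma mem_sumn w i : i \in w -> (i <= sumn w)%N.
Proof. by elim: w => //= a w IHw; rewrite inE => /predU1P[->|/IHw]; lia. Qed.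

Lemma cauchy_deriv i M d (m := i.*2.+1) : (d <= M)%N ->
  DX i (cauchy M d) = if (m <= d)%N
    then (rr i)%:A * hX (kap i) * hY (p m) * cauchy M (d - m) else 0.
Proof.
move=> dM; have om : odd m by rewrite /= odd_double.
have D_half k x : DX i (onehalf ^+ k * x) = onehalf ^+ k * DX i x.
  elim: k => [|k IHk]; first by rewrite !mul1r.
  by rewrite exprS -!mulrA /onehalf !mulr_algl DXZ IHk.
have -> : DX i (cauchy M d) = (rr i)%:A * hX (kap i) * \sum_(w <- swords M)
    onehalf ^+ size w * (hX (wshift (fun a => a - m%:Z) ev (zword w)) * g d (zword w)).
  rewrite raddf_sum /= mulr_sumr big_mkcond; apply: eq_bigr => w _.
  rewrite D_half /g zword_sum eqz_nat; case: eqP => _; last by ring.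
  by rewrite DXM DXhX DXhY ev_deriv rmorphM /= -[_ *: (_ * _)]mulr_algl; ring.
have [md|dm] := leqP m d; last first.
  rewrite big1 ?mulr0 // => w _; rewrite /g zword_sum eqz_nat.
  case: eqP => [E|_]; last by rewrite !mulr0.
  rewrite wshift_eq0 ?rmorph0 ?mul0r ?mulr0 // => u a v /(congr1 (fun w => \sum_(a <- w) a)).
  rewrite zword_sum E big_cat big_cons /= => dE; apply: ev_neg.
  rewrite big_cat big_cons /=; move: dE dm.
  by set x := \sum_(a <- u) a; set y := \sum_(a <- v) a; lia.
have mM : (m <= M)%N by lia.
have downE' w : w \in swords M ->
    4%:R * hX (wshift (fun a => a - m%:Z) ev (zword w)) = down m M f [::] (zword w).
  move=> wM; rewrite downE //; [|exact: cliff_f|].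
    by rewrite (wshift_morph hX).
  by apply/allP => _ /mapP[k kw ->]; have := mem_swords wM kw; lia.
have four_inj (x y : R2) : 4%:R * x = 4%:R * y -> x = y.
  move=> E; rewrite -[x](scalerK (a := 4%:R : K)) ?((pcharf0P K).1 K0) //.
  by rewrite scaler_nat -[x *+ 4]mulr_natl E mulr_natl -scaler_nat scalerK
     ?((pcharf0P K).1 K0).
rewrite -!mulrA; congr (_ * (_ * _)); apply: four_inj.
transitivity (\sum_(w <- swords M)
    onehalf ^+ size w * (down m M f [::] (zword w) * g d (zword w))).
  rewrite mulr_sumr; apply: eq_big_seq => w wM; rewrite -downE' //.
  by ring.
rewrite (down_up onehalfE cliff_f (cliff_g d) mM) /cauchy !mulr_sumr [RHS]big_mkcond.
apply: eq_big_seq => w wM.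
have -> : up m M (g d) (zword w) =
    if sumn w == (d - m)%N then hY (up m M ev (zword w)) else 0.
  rewrite /up raddf_sum /=; case: eqP => [E|nE]; last first.
    rewrite big1 // => j _; rewrite /g !big_cons zword_sum ifF ?mulr0 //.
    by apply/eqP => E; apply: nE; lia.
  apply: eq_bigr => j _; rewrite rmorphM /= rmorph_sign /g !big_cons zword_sum ifT //.
  by rewrite E; lia.
case: eqP => [E|_]; last by rewrite !mulr0.
rewrite ev_up //; last first.
  by apply/allP => _ /mapP[k kw ->]; have := mem_sumn kw; lia.
by rewrite !rmorphM rmorph_nat /f; ring.
Qed.

Lemma phi_cauchy M d : phi (cauchy M d) = (d == 0%N)%:R.
Proof.
rewrite /cauchy raddf_sum /=; case: d => [|d] /=.
  elim: M => [|M IHM] /=.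
    by rewrite big_mkcond big_seq1 /= mul1r /ev -[pfw _ _ _]/1 !rmorph1 mulr1 rmorph1.
  rewrite big_cat IHM big_map big1 => [|w /eqP /=]; [exact: addr0 | lia].
rewrite big_seq_cond big1 // => w /andP[wM /eqP sw].
rewrite !rmorphM /= phiX ?mul0r ?mulr0 //.
case: w wM sw => // a w wM _; apply: ev0_ev.
by have := mem_swords wM (mem_head a w); lia.
Qed.

Lemma exp_cauchy M k : (k <= M.*2)%N ->
  exp_series ker k = if odd k then 0 else cauchy M k./2.
Proof.
elim/ltn_ind: k => k IHk kM; apply/eqP; rewrite -subr_eq0; apply/eqP/uniqX => [i|]; last first.
  rewrite raddfB /= exp_series_eval0 //; case: ifP => ok.
    by rewrite raddf0 subr0; case: (k) ok.
  by rewrite phi_cauchy (_ : (k./2 == 0) = (k == 0))%N ?subrr //; lia.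
rewrite raddfB /= exp_series_deriv //; set m := i.*2.+1.
have -> : mul_series (DX i \o ker) (exp_series ker) k = if (m.*2 <= k)%N
    then (rr i)%:A * hX (kap i) * hY (p m) * exp_series ker (k - m.*2)%N else 0.
  rewrite /mul_series /=; under eq_bigr do rewrite DXker -/m.
  have [mk|km] := leqP m.*2 k; last first.
    by rewrite big1 // => j _; rewrite ifF ?mul0r //; have := ltn_ord j; lia.
  rewrite (bigD1 (Ordinal (mk : (m.*2 < k.+1)%N))) //= eqxx big1 ?addr0 // => j jm.
  by rewrite ifF ?mul0r //; apply: contraNF jm => /eqP jm; apply/eqP/val_inj.
have [ok|ek] := boolP (odd k).
  rewrite raddf0 subr0; have [mk|] := leqP m.*2 k => //.
  rewrite IHk; [|by rewrite /m; lia|by lia].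
  by rewrite ifT ?mulr0 //; rewrite /m in mk *; lia.
rewrite cauchy_deriv; last by lia.
rewrite -/m; have -> : (m <= k./2)%N = (m.*2 <= k)%N by lia.
have [mk|_] := leqP m.*2 k; last by rewrite subrr.
rewrite IHk; [|by rewrite /m; lia|by lia].
rewrite ifF; last by lia.
by rewrite (_ : (k - m.*2)./2 = (k./2 - m)%N) ?subrr //; lia.
Qed.

End TwoAlphabets.
End Neutral.

(** * Specialization to power sums *)

Lemma lrmorph_ext (K : comNzRingType) (I : choiceType) (A : comAlgType K)
    (h1 h2 : {lrmorphism {pring K[I]} -> A}) :
  (forall i, h1 (pvar K i) = h2 (pvar K i)) -> h1 =1 h2.
Proof.
move=> h12; apply: pring_ind => [|f g Ef Eg|c f Ef|i f Ef].
- by rewrite !rmorph1.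
- by rewrite !rmorphD /= Ef Eg.
- by rewrite !linearZ /= Ef.
by rewrite !rmorphM /= Ef h12.
Qed.

Lemma scale_sum_lrmorph (K : comNzRingType) (A B : comAlgType K)
    (h : {lrmorphism A -> B}) (T : Type) (r : seq T) (c : T -> K) (F : T -> A) y :
  \sum_(m <- r) c m *: (h (F m) * y) = h (\sum_(m <- r) c m *: F m) * y.
Proof.
rewrite raddf_sum mulr_suml; apply: eq_bigr => m _.
by rewrite /= linearZ /= scalerAl.
Qed.

Lemma scale_exp_half (K : fieldType) (A : comAlgType K) n (x : A) :
  ((2%:R ^+ n)^-1 : K) *: x = onehalf A ^+ n * x.
Proof.
elim: n => [|n IHn] in x *; first by rewrite invr1 scale1r mul1r.
by rewrite !exprS invfM -scalerA IHn -mulrA [in RHS]/onehalf mulr_algl.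
Qed.

Lemma big_swords_SP (V : nmodType) (n M : nat) (F : seq nat -> V) : (n <= M)%N ->
  \sum_(l <- SP n) F l = \sum_(w <- swords M | sumn w == n) F w.
Proof.
move=> nM; rewrite -(big_map val xpredT F) -[RHS]big_filter; apply: perm_big.
have memS N w : (w \in swords N) = is_spart w && all (leq^~ N) w.
  elim: N w => [|N IHN] w /=.
    rewrite inE; case: w => [|[|x] w] //=; rewrite ?andbF //.
    by rewrite /is_spart inE eqxx andbF.
  rewrite mem_cat IHN; have [|/mapP H] := boolP (w \in map _ _).
    case/mapP => v; rewrite IHN => /andP[/andP[sv v0] vN] ->.
    rewrite orbT /is_spart /= inE negb_or v0 leqnn /=.
    rewrite (path_sortedE (rev_trans ltn_trans)) sv andbT; apply/esym/andP; split.
      by rewrite andbT; apply: sub_all vN => i.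
    by apply: sub_all vN => i /leqW.
  rewrite orbF; apply/andP/andP => -[sw wN]; split=> //.
    by apply: sub_all wN => i /leqW.
  case: w sw wN H => // x w /andP[/=]; rewrite (path_sortedE (rev_trans ltn_trans)).
  move=> /andP[xw sw]; rewrite inE negb_or => /andP[x0 w0] /andP[xN wN] H.
  have xN' : (x <= N)%N.
    rewrite -ltnS ltn_neqAle xN andbT; apply/eqP => E; apply: H; exists w; last by rewrite E.
    by rewrite IHN /is_spart sw w0; apply: sub_all xw => i /=; rewrite E ltnS.
  by rewrite xN'; apply: sub_all xw => i /= /ltnW ix; apply: leq_trans ix xN'.
have uS N : uniq (swords N).
  elim: N => //= N IHN; rewrite cat_uniq IHN map_inj_uniq ?IHN ?andbT //; last by move=> ? ? [].
  apply/hasPn => _ /mapP[v _ ->]; rewrite memS /= ltnn andbF //.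
apply: uniq_perm.
- by rewrite map_inj_uniq ?SP_uniq //; apply: val_inj.
- by rewrite filter_uniq.
move=> w; rewrite mem_filter memS; apply/mapP/andP => [[l]|[/eqP sw /andP[pw _]]].
  rewrite mem_SP => sl ->; split=> //; rewrite (valP l).
  by apply/allP => i /mem_sumn; rewrite (eqP sl) => /leq_trans; apply.
by exists (SPart pw); rewrite ?mem_SP ?sw.
Qed.

Lemma size_pad (T : Type) (x : T) (w : seq T) :
  size (if odd (size w) then rcons w x else w) = (uphalf (size w)).*2.
Proof. by rewrite uphalfE; case: ifP => ow; rewrite ?size_rcons; lia. Qed.

Lemma scale_algM (K : comNzRingType) (A : comAlgType K) (a b : K) (x : A) :
  a%:A * b%:A * x = (a * b) *: x.
Proof. by rewrite mulr_algl -scalerAl mulr_algl scalerA. Qed.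

Lemma mul_lrmorphZ (K : comNzRingType) (A B : comAlgType K)
    (h : {lrmorphism A -> B}) (c : K) (x : B) (y : A) :
  x * h (c *: y) = c *: (x * h y).
Proof. by rewrite linearZ scalerAr. Qed.

Lemma deriv_tensor (K : comNzRingType) (A B : comAlgType K) (hX hY : A -> B)
    (D : A -> A) (DX : B -> B) :
    (forall x y, DX (x * y) = DX x * y + x * DX y) ->
    (forall c x, DX (c *: x) = c *: DX x) ->
    (forall x, DX (hX x) = hX (D x)) -> (forall y, DX (hY y) = 0) ->
  forall c x y, DX (c *: (hX x * hY y)) = c *: (hX (D x) * hY y).
Proof. by move=> DM DZ DXX DXY c x y; rewrite DZ DM DXX DXY mulr0 addr0. Qed.

Section Instance.
Variable K : fieldType.
Hypothesis K0 : [pchar K] =i pred0.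

Lemma qfunE (r : nat) : qfun K r = q (@psum K) r.
Proof. by []. Qed.

Lemma Q2_W (r s : nat) : Q2 K r s = W (@psum K) r s.
Proof.
rewrite /Q2 /W big_ord_recl {1}/wcoef eqxx mul1r [r%:Z + _]addr0 [s%:Z - _]subr0.
rewrite !qfunE big_add1 big_mkord; congr (_ + _).
rewrite mulr_sumr; apply: eq_bigr => k _; rewrite lift0 /wcoef !qfunE mulrA.
by have -> : s%:Z - k.+1%:Z = (s - k.+1)%N by have := ltn_ord k; lia.
Qed.

Lemma schurQ_ev (l : spart) : schurQ K l = ev (@psum K) (zword l).
Proof.
rewrite /schurQ /ev size_map -(pfaffian_pfw (K := K) K0 0); last first.
  by have := size_pad 0 (zword l); rewrite size_map.
congr pfaffian; apply/matrixP => i j; rewrite !mxE.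
have nthE k : nth 0 (if odd (size l) then rcons (zword l) 0 else zword l) k =
    (nth 0%N l k)%:Z.
  have E : nth 0 (zword l) k = (nth 0%N l k)%:Z.
    have [lk|kl] := leqP (size l) k; last by rewrite (nth_map 0%N).
    by rewrite !nth_default ?size_map.
  case: ifP => _ //; rewrite -{}E nth_rcons; case: ltngtP => // kl.
    by rewrite nth_default // ltnW.
  by rewrite kl nth_default.
by rewrite !nthE -!Q2_W.
Qed.

Variables t s : K.

Let DG (i : nat) : {additive Gamma K -> Gamma K} := dpring (i : idx).
Let DX (i : nat) : {additive Gamma2 K -> Gamma2 K} := dpring (inl (i : idx) : idx2).
Let ev0 : {lrmorphism Gamma K -> Gamma K} := psubst (fun _ : idx => 0).
Let hX : {lrmorphism Gamma K -> Gamma2 K} := psubst (fun i => pvar K (inl i : idx2)).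
Let hY : {lrmorphism Gamma K -> Gamma2 K} := psubst (fun i => pvar K (inr i : idx2)).
Let hT : {lrmorphism Gamma K -> Gamma K} :=
  psubst (fun i : idx => Defs.ratio t s i.*2.+1 *: psum K i.*2.+1).
Let isX (x : idx2) := if x is inl _ then true else false.
Let phi : {lrmorphism Gamma2 K -> Gamma2 K} :=
  psubst (fun x : idx2 => if isX x then 0 else pvar K x).

Lemma psum_odd (i : nat) : psum K i.*2.+1 = pvar K (i : idx).
Proof. by rewrite /psum /= odd_double /= uphalf_double. Qed.

Lemma odd_index n : odd n -> {i : nat | n = i.*2.+1}.
Proof. by move=> on; exists n./2; lia. Qed.

Lemma DG_psum i n : odd n -> DG i (psum K n) = (i.*2.+1 == n)%:R.
Proof.
case/odd_index => j ->; rewrite psum_odd eqSS (inj_eq double_inj).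
exact: dpring_var.
Qed.

Lemma ev0_psum n : odd n -> ev0 (psum K n) = 0.
Proof. by case/odd_index => j ->; rewrite psum_odd; apply: psubst_var. Qed.

Lemma uniqG x : (forall i, DG i x = 0) -> ev0 x = 0 -> x = 0.
Proof.
move=> Dx x0; apply: (deriv_uniq K0 (P := xpredT)) => [i _|]; last exact: x0.
exact: Dx.
Qed.

Lemma uniqG2 x : (forall i, DX i x = 0) -> phi x = 0 -> x = 0.
Proof.
move=> Dx x0; apply: (deriv_uniq K0 (P := isX)) => [[i|i] // _|]; last exact: x0.
exact: Dx.
Qed.

Lemma DX_inX i x : DX i (hX x) = hX (DG i x).
Proof.
rewrite -[RHS]mul1r; apply: (deriv_psubst (j := inl (i : idx) : idx2) (i := i : idx)).
by move=> l; rewrite mul1r; apply: dpring_var.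
Qed.

Lemma DX_inY i x : DX i (hY x) = 0.
Proof.
rewrite -[RHS](mul0r (hY (DG i x))).
apply: (deriv_psubst (j := inl (i : idx) : idx2) (i := i : idx)).
by move=> l; rewrite mul0r; apply: dpring_var.
Qed.

Lemma DG_T i x : DG i (hT x) = Defs.ratio t s i.*2.+1 *: hT (DG i x).
Proof.
rewrite -mulr_algl; apply: (deriv_psubst (j := i : idx) (i := i : idx)) => l.
rewrite psum_odd dpringZ mulr_algl.
rewrite (_ : dpring _ _ = (i == l)%:R); last exact: dpring_var.
by have [->|_] := eqVneq i l; rewrite ?scaler0.
Qed.

Lemma phi_inX x : phi (hX x) = hX (ev0 x).
Proof.
have E : phi \o hX =1 hX \o ev0; last exact: E.
apply: lrmorph_ext => i.
transitivity (phi (pvar K (inl i : idx2))).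
  exact: (congr1 phi (psubst_var _ i)).
transitivity (0 : Gamma2 K); first exact: psubst_var.
apply/esym; transitivity (hX 0); last exact: rmorph0.
exact: (congr1 hX (psubst_var _ i)).
Qed.

Lemma ev0_T x : ev0 (hT x) = ev0 x.
Proof.
have E : ev0 \o hT =1 ev0; last exact: E.
apply: lrmorph_ext => i.
transitivity (ev0 (Defs.ratio t s i.*2.+1 *: psum K i.*2.+1)).
  exact: (congr1 ev0 (psubst_var _ i)).
transitivity (0 : Gamma K); last by apply/esym/psubst_var.
by rewrite linearZ /= ev0_psum /= ?odd_double // scaler0.
Qed.

Lemma homog_psumX n : odd n -> homog deg2 n (hX (psum K n)).
Proof.
case/odd_index => i ->; rewrite psum_odd /= psubst_var.
exact: (@homog_var K idx2 deg2 (inl i : idx2)).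
Qed.

Lemma homog_psumY n : odd n -> homog deg2 n (hY (psum K n)).
Proof.
case/odd_index => i ->; rewrite psum_odd /= psubst_var.
exact: (@homog_var K idx2 deg2 (inr i : idx2)).
Qed.

Lemma homog_kernel n : homog deg2 (n + n)%N (kernel_term t s n).
Proof.
rewrite /kernel_term; case: ifP => on; last exact: homog0.
apply: homogZ; rewrite PoszD.
by apply: homogM; [apply: homog_psumX | apply: homog_psumY].
Qed.

Lemma kernel_exponentE k :
  kernel_exponent t s k = if odd k then 0 else kernel_term t s k./2.
Proof.
rewrite /kernel_exponent; case: ifP => ok.
  apply: big1 => n _; rewrite /compl (hcomp_homog _ (@homog_kernel n)) ifF //; lia.
have lt : (k./2 < k.+1)%N by lia.
rewrite (bigD1 (Ordinal lt)) //= /compl (hcomp_homog _ (@homog_kernel _)) ifT; last by lia.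
rewrite big1 ?addr0 // => n nk; rewrite (hcomp_homog _ (@homog_kernel n)) ifF //.
by apply: contraNF nk => /eqP nk; apply/eqP/val_inj => /=; lia.
Qed.

Let rr (i : nat) : K := Defs.ratio t s i.*2.+1.
Let hTX : {lrmorphism Gamma K -> Gamma2 K} := hX \o hT.

Lemma DX_kernel i k : DX i (kernel_exponent t s k) =
  if k == (i.*2.+1).*2 then (rr i)%:A * hTX (kap _ i) * hY (psum K i.*2.+1) else 0.
Proof.
rewrite kernel_exponentE; case: ifP => ok; first by rewrite raddf0 ifF //; lia.
rewrite /kernel_term; case: ifP => on; last by rewrite raddf0 ifF //; lia.
transitivity ((2%:R * Defs.ratio t s k./2 / k./2%:R) *:
    ((i.*2.+1 == k./2)%:R * hY (psum K k./2))).
  transitivity ((2%:R * Defs.ratio t s k./2 / k./2%:R) *: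
      (hX (DG i (psum K k./2)) * hY (psum K k./2))).
    apply: deriv_tensor; [exact: dpringM | exact: dpringZ | |].
      exact: DX_inX.
    exact: DX_inY.
  apply: (congr1 (fun x => _ *: (x * _))).
  by apply: etrans (congr1 hX (DG_psum i on)) _; apply: rmorph_nat.
have -> : (k == i.*2.+1.*2) = (i.*2.+1 == k./2) by lia.
case: eqP => [<-|_]; last by rewrite mul0r scaler0.
have -> : hTX (kap (Gamma K) i) = (2%:R / i.*2.+1%:R : K)%:A.
  by rewrite /kap linearZ rmorph1.
rewrite mul1r (scale_algM (rr i)) /rr; apply: (congr1 (fun c : K => c *: _)).
by rewrite [RHS]mulrCA mulrA.
Qed.

Lemma phi_kernel k : phi (kernel_exponent t s k) = 0.
Proof.
rewrite kernel_exponentE; case: ifP => ok; first exact: raddf0.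
rewrite /kernel_term; case: ifP => on; last exact: raddf0.
rewrite linearZ /= rmorphM /=.
have -> : phi (hX (psum K k./2)) = 0 by rewrite phi_inX ev0_psum // rmorph0.
by rewrite mul0r scaler0.
Qed.

Lemma exp_kernel M k : (k <= M.*2)%N ->
  exp_series (kernel_exponent t s) k =
  if odd k then 0 else cauchy (psum K) hTX hY M k./2.
Proof.
apply: (@exp_cauchy _ _ K0 _ DG ev0 _ _ _ _ _ _ hTX hY DX phi rr).
- by move=> i x y; apply: dpringM.
- by move=> i c x; apply: dpringZ.
- exact: DG_psum.
- exact: ev0_psum.
- exact: uniqG.
- by move=> i x y; apply: dpringM.
- by move=> i c x; apply: dpringZ.
- by move=> i x; rewrite /hTX /= DX_inX DG_T linearZ.
- exact: DX_inY.
- by move=> x x0; rewrite /hTX /= phi_inX ev0_T x0 rmorph0.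
- exact: uniqG2.
- by rewrite kernel_exponentE.
- exact: DX_kernel.
- exact: phi_kernel.
Qed.

Let wt (i : idx) : nat := i.*2.+1.

Lemma homog_qfun (r : nat) : homog wt r (qfun K r).
Proof.
pose f n : Gamma K := if odd n then (2%:R / n%:R : K) *: psum K n else 0.
have hf (n : nat) : homog wt n (f n).
  rewrite /f; case: ifP => on; last exact: homog0.
  apply: homogZ; have [i ->] := odd_index on; rewrite psum_odd.
  exact: (@homog_var K idx wt i).
have hpow k (d : nat) : homog wt d (pow_series f k d).
  elim: k d => [|k IHk] d /=.
    by rewrite /series1; case: eqP => [->|_]; [apply: homog1 | apply: homog0].
  apply: homog_sum => i _ _.
  have -> : d%:Z = (i : nat)%:Z + (d - i)%N by have := ltn_ord i; lia.
  exact: homogM.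
by apply: homog_sum => k _ _; apply: homogZ.
Qed.

Lemma homog_q z : homog wt z (q (psum K) z).
Proof. by case: z => [r|r]; [apply: homog_qfun | apply: homog0]. Qed.

Lemma homog_W a b : homog wt (a + b) (W (psum K) a b).
Proof.
case: b => [b|b]; last exact: homog0.
apply: homog_sum => k _ _.
have hc x : homog wt (a + b%:Z) x -> homog wt (a + b%:Z) (wcoef (Gamma K) k * x).
  rewrite /wcoef; case: eqP => _ hx; first by rewrite mul1r.
  rewrite -signr_odd; case: (odd k).
    by rewrite expr1 mulrN1 mulNr mulr_natl -scaler_nat; apply/homogN/homogZ.
  by rewrite mulr1 mulr_natl -scaler_nat; apply: homogZ.
apply: hc; have -> : a + b%:Z = (a + k%:Z) + (b%:Z - k%:Z) by ring.
by apply: homogM; apply: homog_q.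
Qed.

Lemma homog_ev w : homog wt (\sum_(a <- w) a) (ev (psum K) w).
Proof.
pose P (w : seq int) (x : Gamma K) := homog wt (\sum_(a <- w) a) x.
have main n v : P v (pfw (W (psum K)) n v).
  apply: pfw_ind => [||u x y|u x|a b u v' x]; rewrite /P.
  - by rewrite big_nil; apply: homog1.
  - by move=> u; apply: homog0.
  - exact: homogD.
  - exact: homogN.
  rewrite big_cons !big_cat big_cons /= => hx.
  rewrite (_ : _ + _ = (a + b) + (\sum_(i <- u) i + \sum_(i <- v') i)); last by ring.
  by apply: homogM => //; apply: homog_W.
have := main (uphalf (size w)) (if odd (size w) then rcons w 0 else w).
rewrite /P /ev; case: ifP => _ //.
by rewrite -cats1 big_cat big_seq1 /= addr0.
Qed.

Lemma homog_schurQ (l : spart) : homog wt (sumn l) (schurQ K l).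
Proof. by rewrite schurQ_ev -zword_sum; apply: homog_ev. Qed.

Lemma homog_inX z f : homog wt z f -> homog deg2 z (hX f).
Proof. by apply: homog_psubst => i; apply: (@homog_var K idx2 deg2 (inl i)). Qed.

Lemma homog_inY z f : homog wt z f -> homog deg2 z (hY f).
Proof. by apply: homog_psubst => i; apply: (@homog_var K idx2 deg2 (inr i)). Qed.

Lemma homog_T z f : homog wt z f -> homog wt z (hT f).
Proof.
apply: homog_psubst => i; apply: homogZ; rewrite psum_odd.
exact: (@homog_var K idx wt i).
Qed.

Lemma cauchy_Tts (C : spart -> spart -> K) :
    (forall l : spart,
      Tts t s (schurQ K l) = \sum_(m <- SP (sumn l)) C l m *: schurQ K m) ->
  has_sum
    (fun l : spart =>
       compl (\sum_(m <- SP (sumn l)) C l m *: (inX (schurQ K m) * inY (schurP K l))))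
    (exp_series (kernel_exponent t s)).
Proof.
move=> hC d; pose X (l : spart) : Gamma2 K := hX (hT (schurQ K l)) * hY (schurP K l).
have XE (l : spart) : \sum_(m <- SP (sumn l)) C l m *: (inX (schurQ K m) * inY (schurP K l)) = X l.
  apply: etrans (scale_sum_lrmorph hX _ _ _ _) _.
  by rewrite -hC.
have hXl (l : spart) : homog deg2 (sumn l + sumn l)%N (X l).
  rewrite PoszD; apply: homogM.
    by apply/homog_inX/homog_T/homog_schurQ.
  by apply/homog_inY/homogZ/homog_schurQ.
exists (SP d./2) => r Ur sub.
transitivity (\sum_(l <- r) if d == (sumn l + sumn l)%N then X l else 0).
  by apply: eq_bigr => l _; rewrite XE /compl (hcomp_homog _ (hXl l)).
rewrite (exp_kernel (M := d)); last by lia.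
case: ifP => od; first by rewrite big1 // => l _; rewrite ifF //; lia.
transitivity (\sum_(l <- SP d./2) X l).
  rewrite -big_mkcond -big_filter; apply: perm_big; apply: uniq_perm.
  - exact: filter_uniq.
  - exact: SP_uniq.
  move=> l; rewrite mem_filter mem_SP.
  have -> : (d == (sumn l + sumn l)%N) = (sumn l == d./2) by lia.
  by apply: andb_idr => sl; apply: sub; rewrite mem_SP.
rewrite /cauchy -(big_swords_SP (fun w => onehalf (Gamma2 K) ^+ size w *
  (hTX (ev (psum K) (zword w)) * hY (ev (psum K) (zword w))))); last by lia.
apply: eq_bigr => l _; apply: etrans (mul_lrmorphZ hY _ _ _) _.
by rewrite scale_exp_half schurQ_ev.
Qed.

End Instance.

Lemma pchar_Qts : [pchar Qts] =i pred0.
Proof.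
apply/pcharf0P => n; rewrite -(rmorph_nat (@tofrac {poly {poly rat}})) tofrac_eq0.
by rewrite -!polyC_natr !polyC_eq0 pnatr_eq0.
Qed.

Theorem theorem3p7
  (C : spart -> spart -> Qts)
  (hC : forall l : spart,
     Tts vt vs (schurQ Qts l) = \sum_(m <- SP (sumn l)) C l m *: schurQ Qts m) :
  has_sum
    (fun l : spart =>
       compl (\sum_(m <- SP (sumn l))
                C l m *: (inX (schurQ Qts m) * inY (schurP Qts l))))
    (exp_series (kernel_exponent vt vs)).
Proof. exact: (cauchy_Tts pchar_Qts hC). Qed.
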